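(* Algorithm 1 (described in the context) gives an optimal transmission schedule for the following problem (Q): the rates $r_i$ and transmission times $\tau_{i,j}$ that it produces are feasible for (Q) and attain its minimum. Problem (Q): minimize over $\mathbf r=(r_i)_{1\le i\le N}$ and $\boldsymbol\tau=(\tau_{i,j})_{1\le i\le N,\,1\le j\le M}$, where $\tau_{i,j}=0$ for $j\notin\mathcal C_i$, the transmission energy $$\sum_{i=1}^N\frac{B_i}{r_i}f(r_i)$$ subject to $$\frac{B_i}{r_i}-\sum_{j\in\mathcal C_i}\tau_{i,j}=0\quad(1\le i\le N),\qquad \sum_{i\in\mathcal F_j}\tau_{i,j}-|\mathcal E_j|\le 0\quad(1\le j\le M),$$ $$\tau_{i,j}\ge 0\quad(1\le j\le M,\ i\in\mathcal F_j),\qquad r_i\ge 0\quad(1\le i\le N).$$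
   Context: Packets: there are $N$ packets; packet $i$ has size $B_i>0$, arrival instant $t_{a,i}$ and deadline $t_{d,i}>t_{a,i}$, with $0=t_{a,1}<t_{a,2}<\dots<t_{a,N}$; the deadlines are otherwise arbitrary. Let $T=\max_i t_{d,i}$. The life time of packet $i$ is $\mathcal L_i=[t_{a,i},t_{d,i}]$. Epochs: let $0=t_0<t_1<\dots<t_M=T$ be the distinct values among all arrival instants and deadlines, in ascending order. Epoch $j$ is $\mathcal E_j=[t_{j-1},t_j]$, with length $|\mathcal E_j|=t_j-t_{j-1}$, $1\le j\le M$. Put $\mathcal C_i=\{j:\mathcal E_j\subseteq\mathcal L_i\}$ (epochs contained in the life time of packet $i$) and $\mathcal F_j=\{i:\mathcal E_j\subseteq\mathcal L_i\}$ (packets that can be transmitted in epoch $j$). Power function: transmitting at rate $r$ uses power $f(r)\ge 0$, where $f$ is a convex and increasing function on $[0,\infty)$. Meaning of the variables: $r_i$ is the constant rate at which packet $i$ is transmitted, and $\tau_{i,j}$ is the time spent transmitting packet $i$ in epoch $j$. Algorithm 1. Maintain a set $\mathcal K$ of packets already scheduled and updated instants $\bar t_{a,i},\bar t_{d,i}$ for $i\notin\mathcal K$. Initially $\mathcal K=\emptyset$, $\bar t_{a,i}=t_{a,i}$, $\bar t_{d,i}=t_{d,i}$, and $\varphi_1$ is the identity map of $[0,T]$. In round $g=1,2,\dots$: 1. Consider all sub-intervals $\bar{\mathcal T}_{k,l}=[\bar t_{a,k},\bar t_{d,l}]$ with $k,l\in\{1,\dots,N\}\setminus\mathcal K$ and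 $\bar t_{a,k}<\bar t_{d,l}$ that contain the updated life time $\bar{\mathcal L}_i=[\bar t_{a,i},\bar t_{d,i}]$ of at least one packet $i\notin\mathcal K$. Put $\mathcal H(\bar{\mathcal T}_{k,l})=\{i\notin\mathcal K:\bar{\mathcal L}_i\subseteq\bar{\mathcal T}_{k,l}\}$ and $$r(\bar{\mathcal T}_{k,l})=\frac{\sum_{i\in\mathcal H(\bar{\mathcal T}_{k,l})}B_i}{\bar t_{d,l}-\bar t_{a,k}}.$$ 2. Choose a sub-interval $\bar{\mathcal T}^{*g}=[\alpha,\delta]$ maximizing $r(\bar{\mathcal T}_{k,l})$, and let $\mathcal H_g=\mathcal H(\bar{\mathcal T}^{*g})$ and $\rho_g=r(\bar{\mathcal T}^{*g})$. 3. Shift back to real time: let $S_g$ be the set of $t\in[0,T]\setminus(S_1\cup\dots\cup S_{g-1})$ with $\varphi_g(t)\in\bar{\mathcal T}^{*g}$ (up to finitely many points). At each $t\in S_g$, among the packets of $\mathcal H_g$ that have arrived ($t_{a,i}\le t$), have not finished transmission by time $t$, and have $t_{d,i}\ge t$, transmit one with the smallest deadline $t_{d,i}$, at rate $\rho_g$; if there is none, idle at time $t$. 4. Replace $\mathcal K$ by $\mathcal K\cup\mathcal H_g$. If $\mathcal K=\{1,\dots,N\}$, stop. Otherwise let $\sigma_g$ be the map with $\sigma_g(x)=x$ for $x\le\alpha$, $\sigma_g(x)=\alpha$ for $\alpha<x\le\delta$, and $\sigma_g(x)=x-(\delta-\alpha)$ for $x>\delta$. Replace $\bar t_{a,i}$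 by $\sigma_g(\bar t_{a,i})$ and $\bar t_{d,i}$ by $\sigma_g(\bar t_{d,i})$ for all $i\notin\mathcal K$, set $\varphi_{g+1}=\sigma_g\circ\varphi_g$, and go to the next round. The schedule produced by Algorithm 1 gives $r_i=\rho_g$ for $i\in\mathcal H_g$, and $\tau_{i,j}$ equal to the total time during epoch $\mathcal E_j$ in which packet $i$ is transmitted.
   Formalization: The formal theorem adds the assumption f(0)=0 (no power at zero rate); without it the claim fails, e.g. one packet with B=1, life time [0,1] and f(r)=1+r, where rate 2 uses less energy than the algorithm's rate 1. *)

(* Defs.v *)
From mathcomp Require Import all_boot all_order all_algebra.
From mathcomp Require Import all_classical all_reals all_analysis.

Set Implicit Arguments.
Unset Strict Implicit.
Unset Printing Implicit Defensive.
Import Order.TTheory GRing.Theory Num.Theory.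
Local Open Scope ring_scope.

(* There are n.+1 >= 1 packets, numbered from 0 by 'I_n.+1;
   B, ta and td give their sizes, arrival instants and deadlines. *)

Section Epochs.
Context {R : realType} {n : nat}.
Variables (ta td : 'I_n.+1 -> R).

Definition horizon : R := \big[Num.max/td ord0]_i td i.

Definition lifetime (i : 'I_n.+1) : set R := `[ta i, td i]%classic.

Definition instants : seq R := sort <=%R (undup (codom ta ++ codom td)).

Definition instant (j : nat) : R := nth 0 instants j.

Definition nb_epochs : nat := (size instants).-1.

(* Epochs are numbered from 0: epoch j is [t_j, t_(j+1)]. *)
Definition epoch (j : 'I_nb_epochs) : set R :=
  `[instant j, instant j.+1]%classic.

Definition epoch_length (j : 'I_nb_epochs) : R := instant j.+1 - instant j.

Definition epochs_of (i : 'I_n.+1) : {set 'I_nb_epochs} :=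
  [set j | `[< (epoch j `<=` lifetime i)%classic >]].

Definition packets_of (j : 'I_nb_epochs) : {set 'I_n.+1} :=
  [set i | `[< (epoch j `<=` lifetime i)%classic >]].

End Epochs.

Arguments epochs_of {R n} ta td i.
Arguments packets_of {R n} ta td j.
Arguments epoch {R n} ta td j.
Arguments epoch_length {R n} ta td j.

Section Problem.
Context {R : realType} {n : nat}.
Variables (B ta td : 'I_n.+1 -> R).

Notation M := (nb_epochs ta td).
Implicit Types (r : 'I_n.+1 -> R) (tau : 'I_n.+1 -> 'I_M -> R).

Definition energy (f : R -> R) r : R := \sum_i B i / r i * f (r i).

(* The condition r i != 0 says that B i / r i is defined; it is needed because
   B i / 0 = 0 in MathComp, whereas the rate 0 never delivers a packet. *)
Definition feasible r tau : Prop :=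
  [/\ forall i j, j \notin epochs_of ta td i -> tau i j = 0,
      forall i, r i != 0 /\
        B i / r i - \sum_(j in epochs_of ta td i) tau i j = 0,
      forall j, \sum_(i in packets_of ta td j) tau i j - epoch_length ta td j <= 0,
      forall j i, i \in packets_of ta td j -> 0 <= tau i j
    & forall i, 0 <= r i].

Definition optimal (f : R -> R) r tau : Prop :=
  feasible r tau /\
  forall r' tau', feasible r' tau' -> energy f r <= energy f r'.

End Problem.

Arguments feasible {R n} B ta td r tau.
Arguments optimal {R n} B ta td f r tau.

Section Algorithm.
Context {R : realType} {n : nat}.
Variables (B ta td : 'I_n.+1 -> R).

(* The state at the start of round g: the packets already scheduled, the updated
   arrival instants and deadlines, the map phi_g from real time to updated time,
   and the part S_1, ..., S_(g-1) of real time used by the previous rounds. *)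
Record state := State {
  scheduled : {set 'I_n.+1};
  abar : 'I_n.+1 -> R;
  dbar : 'I_n.+1 -> R;
  phi : R -> R;
  used : set R }.

Definition init : state := State finset.set0 ta td id set0.

Implicit Types (s : state) (k l i : 'I_n.+1).

Definition window s k l : set R := `[abar s k, dbar s l]%classic.

Definition inside s k l : {set 'I_n.+1} :=
  [set i | (i \notin scheduled s) &&
           `[< (`[abar s i, dbar s i] `<=` window s k l)%classic >]].

Definition intensity s k l : R :=
  (\sum_(i in inside s k l) B i) / (dbar s l - abar s k).

Definition candidate s k l : bool :=
  [&& k \notin scheduled s, l \notin scheduled s, abar s k < dbar s l
    & inside s k l != finset.set0].

Definition critical s k l : Prop :=
  candidate s k l /\
  forall k' l', candidate s k' l' -> intensity s k' l' <= intensity s k l.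

Definition slot s k l : set R :=
  [set t | [/\ 0 <= t <= horizon td, ~ used s t & window s k l (phi s t)]]%classic.

Definition contract (a d x : R) : R :=
  if x <= a then x else if x <= d then a else x - (d - a).

Definition next_state s k l : state :=
  let sigma := contract (abar s k) (dbar s l) in
  State (scheduled s :|: inside s k l) (sigma \o abar s) (sigma \o dbar s)
        (sigma \o phi s) (used s `|` slot s k l)%classic.

(* In what follows, x t = Some i means that packet i is transmitted at the
   instant t, and x t = None that the transmitter is idle at t. *)

Definition sent (x : R -> option 'I_n.+1) s k l i (t : R) : R :=
  intensity s k l *
  fine (lebesgue_measure (slot s k l `&` [set u | u <= t /\ x u = Some i])%classic).

Definition eligible (x : R -> option 'I_n.+1) s k l i (t : R) : Prop :=
  [/\ i \in inside s k l, ta i <= t <= td i & sent x s k l i t < B i].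

Definition round_spec (r : 'I_n.+1 -> R) (x : R -> option 'I_n.+1) s k l : Prop :=
  [/\ critical s k l,
      forall i, i \in inside s k l -> r i = intensity s k l
    & forall t, slot s k l t ->
        match x t with
        | Some i => eligible x s k l i t /\
                    forall i', eligible x s k l i' t -> td i <= td i'
        | None => forall i, ~ eligible x s k l i t
        end].

(* The choice of a critical sub-interval and the choice between packets with
   equal deadlines are free, so the algorithm is a relation: "run r x s" means
   that, from the state s on, it may assign the rates r and the transmissions x. *)
Inductive run (r : 'I_n.+1 -> R) (x : R -> option 'I_n.+1) : state -> Prop :=
| run_stop s k l :
    round_spec r x s k l ->
    scheduled (next_state s k l) = [set: 'I_n.+1] ->
    (forall t, ~ used (next_state s k l) t -> x t = None) ->
    run r x s
| run_next s k l :
    round_spec r x s k l ->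
    scheduled (next_state s k l) <> [set: 'I_n.+1] ->
    run r x (next_state s k l) ->
    run r x s.

(* Measurability gives a meaning to the time spent on a packet: when deadlines
   are equal, the rule alone would allow arbitrary switching between packets. *)
Definition algorithm1 (r : 'I_n.+1 -> R)
    (tau : 'I_n.+1 -> 'I_(nb_epochs ta td) -> R) : Prop :=
  exists x : R -> option 'I_n.+1,
    [/\ forall i, measurable [set t | x t = Some i]%classic,
        run r x init
      & forall i j, tau i j =
          fine (lebesgue_measure
                  (epoch ta td j `&` [set t | x t = Some i])%classic)].

End Algorithm.

Arguments algorithm1 {R n} B ta td r tau.

(* Main.v *)
Require Import Defs.
From mathcomp Require Import all_boot all_order all_algebra.
From mathcomp Require Import all_classical all_reals all_analysis.
From mathcomp Require Import measurable_realfun ring lra zify.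

Set Implicit Arguments.
Unset Strict Implicit.
Unset Printing Implicit Defensive.
Import Order.TTheory GRing.Theory Num.Theory.
Local Open Scope ring_scope.

(** Optimality: for a convex [f] with [f 0 = 0], a subgradient at the rate of a packet
    bounds the change of its energy by [h] times the change of its transmission
    time, where [h] is nonnegative and nondecreasing in the rate.  The critical
    intensities decrease from round to round, the packets scheduled in the first
    rounds fill the time removed by these rounds, and no feasible schedule gives
    them more, since their life times lie in that time; summation by parts
    concludes.

    Feasibility: if a packet of a critical window were not finished, then from the
    last moment at which nothing due by its deadline was transmitted up to that
    deadline the transmitter would be busy with packets living inside this period,
    whose load is at most the critical intensity times its length.

    Existence: giving each packet, in the order of the deadlines, the first free time
    of its life time yields an earliest-deadline-first schedule. *)

(** * Subgradients of a convex function on the half-line *)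

(** Every chord ending at [r] from the left has a slope at most that of every chord leaving [r] to
    the right, so the supremum of the left slopes is a subgradient. *)
Lemma convex_subgradient (R : realType) (f : R -> R) (r : R) :
  convex_function (`[0, +oo[%classic : set R) f -> 0 < r ->
  exists s, forall y, 0 <= y -> f r + s * (y - r) <= f y.
Proof.
move=> fconv r0.
have chord y z : 0 <= y -> y < r -> r < z ->
    (f r - f y) / (r - y) <= (f z - f r) / (z - r).
  move=> y0 yr rz.
  have t0 : 0 <= (z - r) / (z - y) by apply: divr_ge0; lra.
  have t1 : (z - r) / (z - y) <= 1 by rewrite ler_pdivrMr; lra.
  have y_in : y \in `[0, +oo[%classic by rewrite inE /= in_itv /= y0.
  have z_in : z \in `[0, +oo[%classic.
    by rewrite inE /= in_itv /= andbT; lra.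
  have h : f ((z - r) / (z - y) * y + (1 - (z - r) / (z - y)) * z) <=
      (z - r) / (z - y) * f y + (1 - (z - r) / (z - y)) * f z.
    exact: (fconv (Itv01 t0 t1) y z y_in z_in).
  move: h.
  have -> : (z - r) / (z - y) * y + (1 - (z - r) / (z - y)) * z = r by field; lra.
  move=> h; rewrite ler_pdivrMr ?subr_gt0// mulrAC ler_pdivlMr ?subr_gt0//.
  move: h; have -> : (z - r) / (z - y) * f y + (1 - (z - r) / (z - y)) * f z
    = ((z - r) * f y + (r - y) * f z) / (z - y) by field; lra.
  by rewrite ler_pdivlMr; lra.
(* Since [0 < r], the chord from 0 belongs to [E], so [sup E] is a genuine supremum. *)
pose E := [set (f r - f y) / (r - y) | y in [set y | 0 <= y < r]]%classic.
have E0 : (E !=set0)%classic.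
  by exists ((f r - f 0) / (r - 0)), 0 => //=; rewrite lexx.
have ubE z : r < z -> ubound E ((f z - f r) / (z - r)).
  by move=> rz _ [y /andP[y0 yr] <-]; exact: chord.
have hE : has_ubound E by exists ((f (r + 1) - f r) / (r + 1 - r)); apply: ubE; lra.
exists (sup E) => y y0; have [yr|yr|->] := ltgtP y r; last by lra.
- have : (f r - f y) / (r - y) <= sup E.
    by apply: ub_le_sup => //; exists y => //=; rewrite y0.
  by rewrite ler_pdivrMr; [lra|rewrite subr_gt0].
- have : sup E <= (f y - f r) / (y - r) by apply: ge_sup => //; exact: ubE.
  by rewrite ler_pdivlMr; [lra|rewrite subr_gt0].
Qed.

(** * Lengths of sets of real time *)

Section Length.
Context {R : realType}.
Local Open Scope classical_set_scope.
Implicit Types A B : set R.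

(** [fine] turns an infinite measure into 0, so monotonicity and additivity of [len] are stated
    under [finite_length]. *)
Definition len A : R := fine (lebesgue_measure A).

Definition finite_length A : Prop :=
  measurable A /\ (lebesgue_measure A < +oo)%E.

Lemma len_ge0 A : 0 <= len A.
Proof. by rewrite /len fine_ge0. Qed.

Lemma finite_lengthE A : finite_length A -> lebesgue_measure A = (len A)%:E.
Proof. by case=> _ Aoo; rewrite fineK// ge0_fin_numE. Qed.

Lemma finite_length_sub A B : measurable A -> A `<=` B -> finite_length B ->
  finite_length A.
Proof.
move=> mA AB [mB Boo]; split => //; apply: le_lt_trans Boo.
by apply: le_measure; rewrite ?inE.
Qed.

Lemma le_len A B : measurable A -> A `<=` B -> finite_length B -> len A <= len B.
Proof.
move=> mA AB fB; have fA := finite_length_sub mA AB fB.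
rewrite -lee_fin -!finite_lengthE//.
by case: fB => mB _; apply: le_measure; rewrite ?inE.
Qed.

Lemma finite_length_itv (a b : R) (x y : bool) :
  finite_length [set` Interval (BSide x a) (BSide y b)].
Proof.
split; first exact: measurable_itv.
by rewrite lebesgue_measure_itv /=; case: ifP => _; rewrite ?ltry// -EFinB ltry.
Qed.

Lemma len_itv (a b : R) (x y : bool) : a <= b ->
  len [set` Interval (BSide x a) (BSide y b)] = b - a.
Proof.
move=> ab; rewrite /len lebesgue_measure_itv /= lte_fin.
by case: ltgtP ab => // -> _; rewrite subrr.
Qed.

Lemma len_split A B : finite_length A -> measurable B ->
  len A = len (A `\` B) + len (A `&` B).
Proof.
move=> fA mB; have mA := fA.1.
have fD : finite_length (A `\` B).
  by apply: finite_length_sub fA; [exact: measurableD|move=> t []].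
have fI : finite_length (A `&` B).
  by apply: finite_length_sub fA; [exact: measurableI|move=> t []].
apply/EFin_inj; rewrite EFinD -!finite_lengthE//.
by rewrite -measureDI.
Qed.

Lemma finite_lengthU A B : finite_length A -> finite_length B ->
  finite_length (A `|` B).
Proof.
move=> fA fB; split; first exact: measurableU fA.1 fB.1.
apply: (@le_lt_trans _ _ (lebesgue_measure A + lebesgue_measure B)%E).
  by have [mA _] := fA; have [mB _] := fB; apply: measureU2.
by rewrite (finite_lengthE fA) (finite_lengthE fB) -EFinD ltry.
Qed.

Lemma len_setU A B : finite_length A -> finite_length B ->
  len (A `|` B) <= len A + len B.
Proof.
move=> fA fB; have fU := finite_lengthU fA fB.
rewrite -lee_fin EFinD -!finite_lengthE//.
by have [mA _] := fA; have [mB _] := fB; apply: measureU2.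
Qed.

Lemma len0 : len set0 = 0.
Proof. by rewrite /len measure0. Qed.

Lemma finite_length0 : finite_length set0.
Proof. by split; [exact: measurable0|rewrite measure0 ltry]. Qed.

Lemma len_set1 (a : R) : len [set a] = 0.
Proof. by rewrite /len lebesgue_measure_set1. Qed.

Lemma finite_length_set1 (a : R) : finite_length [set a].
Proof. by split; [exact: measurable_set1|rewrite lebesgue_measure_set1 ltry]. Qed.

Lemma len_subset0 A B : measurable A -> A `<=` B -> finite_length B ->
  len B = 0 -> len A = 0.
Proof.
move=> mA AB fB B0; apply/eqP; rewrite eq_le len_ge0 andbT -B0.
exact: le_len.
Qed.

Lemma len_point C : measurable C ->
  (forall x y, C x -> C y -> x = y) -> len C = 0.
Proof.
move=> mC CP; have [->|/set0P [x Cx]] := eqVneq C set0; first exact: len0.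
apply: (@len_subset0 _ [set x]) => //; last exact: len_set1.
  by move=> y Cy /=; exact: CP.
exact: finite_length_set1.
Qed.

Lemma len_subU A B C : measurable A -> finite_length B -> finite_length C ->
  A `<=` B `|` C -> len A <= len B + len C.
Proof.
move=> mA fB fC AB; apply: le_trans (len_setU fB fC).
by apply: le_len => //; exact: finite_lengthU.
Qed.

(** Induction on the list: once [F i] is removed from [A], the remaining sets cover the rest. *)
Lemma len_cover (I : eqType) (s : seq I) (F : I -> set R) A :
  finite_length A -> (forall i, i \in s -> finite_length (F i)) ->
  (forall t, A t -> exists2 i, i \in s & F i t) ->
  len A <= \sum_(i <- s) len (F i).
Proof.
elim: s A => [|i s IH] A fA fF AF.
  rewrite big_nil; have -> : A = set0 by apply/seteqP; split=> // t /AF[].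
  by rewrite len0.
rewrite big_cons; have fi : finite_length (F i) by apply: fF; rewrite mem_head.
have cov t : A t -> F i t \/ exists2 j, j \in s & F j t.
  move=> /AF[j]; rewrite inE => /orP[/eqP ->|js Fj]; first by left.
  by right; exists j.
have fAD : finite_length (A `\` F i).
  by apply: (finite_length_sub _ _ fA); [exact: measurableD fA.1 fi.1|move=> t []].
have AD : len (A `\` F i) <= \sum_(j <- s) len (F j).
  apply: IH => // [j js|t [At Fit]].
    by apply: fF; rewrite inE js orbT.
  by case: (cov t At).
apply: le_trans (lerD (lexx _) AD); apply: (len_subU fA.1 fi fAD).
by move=> t At; have [?|?] := pselect (F i t); [left|right].
Qed.

Lemma len_packing (I : eqType) (s : seq I) (F : I -> set R) A :
  uniq s -> finite_length A ->
  (forall i, i \in s -> measurable (F i)) ->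
  (forall i, i \in s -> F i `<=` A) ->
  (forall i j t, F i t -> F j t -> i = j) ->
  \sum_(i <- s) len (F i) <= len A.
Proof.
elim: s A => [|i s IH] A /=; first by rewrite big_nil len_ge0.
move=> /andP[is_ us] fA mF FA dF; rewrite big_cons.
have mi : measurable (F i) by apply: mF; rewrite mem_head.
rewrite (len_split fA mi) addrC lerD//.
  apply: IH => //.
  - by apply: (finite_length_sub _ _ fA); [exact: measurableD fA.1 mi|move=> t []].
  - by move=> j js; apply: mF; rewrite inE js orbT.
  - move=> j js t Fjt; split; first by apply: (FA j); rewrite ?inE ?js ?orbT.
    by move=> Fit; move: is_; rewrite (dF i j t Fit Fjt) js.
suff -> : A `&` F i = F i by [].
by apply/seteqP; split=> [t []//|t Ft]; split=> //; apply: (FA i); rewrite ?mem_head.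
Qed.

End Length.

(** * Clamping to a window and contracting it *)

Definition clamp (R : realType) (a d x : R) : R := Num.min (Num.max x a) d.

(* Splits innermost comparisons first, as an outer one may compare conditionals. *)
Ltac case_order :=
  rewrite ?/Defs.contract ?/clamp /Order.max /Order.min;
  repeat match goal with
  | |- context [if (?x <= ?y)%R then _ else _] =>
    lazymatch constr:((x, y)) with
    | context [if _ then _ else _] => fail | _ => case: (leP x y) => ? end
  | |- context [if (?x < ?y)%R then _ else _] =>
    lazymatch constr:((x, y)) with
    | context [if _ then _ else _] => fail | _ => case: (ltP x y) => ? end
  end; lra.

Lemma clamp_lo (R : realType) (a d x : R) : a <= d -> x <= a -> clamp a d x = a.
Proof. by case_order. Qed.

Lemma clamp_hi (R : realType) (a d x : R) : a <= d -> d <= x -> clamp a d x = d.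
Proof. by case_order. Qed.

Lemma clamp_homo (R : realType) (a d x y : R) : x <= y ->
  clamp a d x <= clamp a d y.
Proof. by case_order. Qed.

(** [clamp a d x - a] is the length of the part of the window before [x], which is what contraction
    takes away. *)
Lemma contractE (R : realType) (a d x : R) : a <= d ->
  Defs.contract a d x = x - clamp a d x + a.
Proof. by case_order. Qed.

(** This bound is stable under composition, hence holds for every [phi]; continuity and
    measurability of [phi] follow from it. *)
Lemma contract_lipschitz (R : realType) (a d x y : R) : a <= d -> x <= y ->
  0 <= Defs.contract a d y - Defs.contract a d x <= y - x.
Proof. by case_order. Qed.

(** * Nondecreasing 1-Lipschitz maps: continuity, measurability, intermediate values *)

Section Continuity.
Import numFieldNormedType.Exports.

Lemma lipschitz_continuous (R : realType) (g : R -> R) :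
  (forall t u, t <= u -> 0 <= g u - g t <= u - t) -> continuous g.
Proof.
move=> gP x; apply/cvgrPdist_lt => e e0; near=> y.
have xy : `|x - y| < e by near: y; apply: cvgr_dist_lt.
apply: le_lt_trans xy; have [/gP|/ltW/gP] := leP x y => h.
  by rewrite distrC [leRHS]distrC !ger0_norm; lra.
by rewrite !ger0_norm; lra.
Unshelve. all: by end_near. Qed.

Lemma measurable_lipschitz_preimage (R : realType) (g : R -> R) (A : set R) :
  (forall t u, t <= u -> 0 <= g u - g t <= u - t) -> measurable A ->
  measurable (g @^-1` A)%classic.
Proof.
move=> /lipschitz_continuous cg mA; rewrite -[(_ @^-1` _)%classic]setTI.
by apply: (continuous_measurable_fun cg).
Qed.

Lemma lipschitz_IVT (R : realType) (g : R -> R) (t u c : R) :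
  (forall t u, t <= u -> 0 <= g u - g t <= u - t) -> t <= u ->
  g t <= c -> c <= g u -> exists2 v, t <= v <= u & g v = c.
Proof.
move=> /lipschitz_continuous cg tu tc cu.
have [|v] := IVT tu (continuous_subspaceT cg) (v := c).
  by rewrite ge_min le_max tc cu orbT.
by rewrite in_itv /=; exists v.
Qed.

End Continuity.

(** * The invariant kept by the rounds *)

Section Invariant.
Context {R : realType} {n : nat}.
Variables (B ta td : 'I_n.+1 -> R).
Local Notation T := (horizon td).
Local Open Scope classical_set_scope.

Lemma le_horizon i : td i <= T.
Proof. exact: le_bigmax. Qed.

Record inv (s : @state R n) : Prop := Inv {
  phi_lip : forall t u, t <= u -> 0 <= phi s u - phi s t <= u - t;
  phi_0 : phi s 0 = 0;
  abarE : forall i, abar s i = phi s (ta i);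
  dbarE : forall i, dbar s i = phi s (td i);
  measurable_used : measurable (used s);
  scheduled_flat : forall i, i \in scheduled s -> phi s (ta i) = phi s (td i);
  unscheduled_lt : forall i, i \notin scheduled s -> abar s i < dbar s i;
  phi_incr : forall t u, ~ used s t -> ~ used s u -> 0 <= t -> t < u -> u <= T ->
    phi s t < phi s u;
  len_unused : forall t u, 0 <= t -> t <= u -> u <= T ->
    len (`]t, u] `\` used s) = phi s u - phi s t }.

Lemma inv_init : (forall i, ta i < td i) -> inv (init ta td).
Proof.
move=> ta_td; split => //=.
- by move=> t u tu; lra.
- by move=> i; rewrite inE.
- move=> t u t0 tu uT; rewrite setD0; exact: len_itv.
Qed.

Lemma phi_homo s t u : inv s -> t <= u -> phi s t <= phi s u.
Proof. by move=> Is /(phi_lip Is); lra. Qed.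

Lemma abar_ge0 s k : (forall i, 0 <= ta i) -> inv s -> 0 <= abar s k.
Proof. by move=> ta_ge0 Is; rewrite (abarE Is) -[leLHS](phi_0 Is) (phi_homo Is). Qed.

Lemma measurable_preimage_phi s k l : inv s -> measurable (phi s @^-1` window s k l).
Proof.
move=> Is; apply: measurable_lipschitz_preimage (phi_lip Is) _.
exact: measurable_itv.
Qed.

Lemma slotE s k l :
  slot td s k l = (`[0, T] `&` ~` used s) `&` phi s @^-1` window s k l.
Proof.
apply/seteqP; split=> t /=; rewrite ?in_itv /=.
  by case=> [? ? ?]; split.
by case=> -[? ?] ?; split.
Qed.

Lemma measurable_slot s k l : inv s -> measurable (slot td s k l).
Proof.
move=> Is; rewrite slotE; apply: measurableI; last exact: measurable_preimage_phi.
by apply: measurableI; [exact: measurable_itv|apply: measurableC; exact: measurable_used].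
Qed.

Lemma len_slot_itv s k l t u : inv s -> abar s k <= dbar s l ->
  0 <= t -> t <= u -> u <= T ->
  len (`]t, u] `&` slot td s k l) =
  clamp (abar s k) (dbar s l) (phi s u) - clamp (abar s k) (dbar s l) (phi s t).
Proof.
move=> Is; set a := abar s k; set d := dbar s l => ad t0 tu uT.
have mS : measurable (`]t, u] `&` slot td s k l).
  by apply: measurableI; [exact: measurable_itv|exact: measurable_slot].
have mU := measurable_used Is.
have ptu := phi_homo Is tu.
have slotP v : (`]t, u] `&` slot td s k l) v <->
    [/\ t < v <= u, ~ used s v & a <= phi s v <= d].
  split=> [[] /=|[/andP[tv vu] Uv pv]].
    by rewrite in_itv /= => tvu [_ ?]; rewrite /window /= in_itv.
  split=> /=; first by rewrite in_itv /= tv.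
  by split=> //; apply/andP; split; lra.
(* In this case and the next the clock stays on one side of the window, and both clamped values
   coincide. *)
have [ua|au] := ltP (phi s u) a.
  rewrite (_ : _ `&` _ = set0) ?len0.
    by rewrite !clamp_lo ?subrr//; lra.
  apply/seteqP; split=> // v /slotP[/andP[tv vu] _ /andP[av _]].
  by have := phi_homo Is vu; lra.
have [dt|td_] := ltP d (phi s t).
  rewrite (_ : _ `&` _ = set0) ?len0.
    by rewrite !clamp_hi ?subrr//; lra.
  apply/seteqP; split=> // v /slotP[/andP[tv vu] _ /andP[_ vd]].
  by have := phi_homo Is (ltW tv); lra.
have level c : phi s t <= c -> c <= phi s u -> exists2 v, t <= v <= u & phi s v = c.
  exact: lipschitz_IVT (phi_lip Is) tu.
pose N c := `]t, u] `&` ~` used s `&` phi s @^-1` [set c].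
have mN c : measurable (N c).
  apply: measurableI.
    by apply: measurableI; [exact: measurable_itv|exact: measurableC].
  exact: measurable_lipschitz_preimage (phi_lip Is) _.
have fN c : finite_length (N c).
  apply: (finite_length_sub (mN c) _ (finite_length_itv t u false false)).
  by move=> v [[]].
have null c : len (N c) = 0.
  apply: len_point => // v w [[/=]]; rewrite in_itv /= => /andP[tv vu] Uv pv [[/=]].
  rewrite in_itv /= => /andP[tw wu] Uw pw.
  have [vw|wv|//] := ltgtP v w.
    by have := phi_incr Is Uv Uw (ltW (le_lt_trans t0 tv)) vw (le_trans wu uT); lra.
  by have := phi_incr Is Uw Uv (ltW (le_lt_trans t0 tw)) wv (le_trans vu uT); lra.
pose c := Num.max (phi s t) a; pose e := Num.min (phi s u) d.
have -> : clamp a d (phi s t) = c by rewrite /clamp /c; case_order.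
have -> : clamp a d (phi s u) = e by rewrite /clamp /e; case_order.
have [ce tc cu te eu] : [/\ c <= e, phi s t <= c, c <= phi s u,
    phi s t <= e & e <= phi s u].
  by rewrite /c /e; split; case_order.
have [ac ed] : a <= c /\ e <= d by rewrite /c /e; split; case_order.
have [v [w [tv vw wu vc we]]] : exists v w,
    [/\ t <= v, v <= w, w <= u, phi s v = c & phi s w = e].
  have [v /andP[tv vu] vc] := level c tc cu.
  have [w /andP[tw wu] we] := level e te eu.
  have [wv|vw] := ltP w v; last by exists v, w.
  (* Instants in the wrong order force [c = e], so [v] serves for both. *)
  by exists v, v; split=> //; have := phi_homo Is (ltW wv); lra.
have fW : finite_length (`]v, w] `\` used s).
  apply: (finite_length_sub _ _ (finite_length_itv v w false false)).
    by apply: measurableD => //; exact: measurable_itv.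
  by move=> x [].
have := len_unused Is (le_trans t0 tv) vw (le_trans wu uT); rewrite vc we => <-.
apply/le_anti/andP; split.
  have -> : len (`]v, w] `\` used s) = len (`]v, w] `\` used s) + (len (N c) + len (N e)).
    by rewrite !null; lra.
  apply: (le_trans _ (lerD (lexx _) (len_setU (fN c) (fN e)))).
  apply: len_subU => //; first exact: finite_lengthU.
  move=> x /slotP[/andP[tx xu] Ux /andP[ax xd]].
  have txu : `]t, u] x by rewrite /= in_itv /= tx.
  (* Slot instants up to [v] are at level [c], and those after [w] at level [e]. *)
  have [xv|vx] := leP x v.
    right; left; split=> //=; apply/le_anti; move: ax; rewrite -vc (phi_homo Is xv) /=.
    by move: (phi_homo Is (ltW tx)); rewrite vc /c; case_order.
  have [xw|wx] := leP x w; first by left; split=> //=; rewrite in_itv /= vx.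
  right; right; split=> //=; apply/le_anti; rewrite -we (phi_homo Is (ltW wx)) andbT.
  by move: (phi_homo Is xu); rewrite we /e; case_order.
apply: le_len => //; first by exact: fW.1.
  move=> x [/=]; rewrite in_itv /= => /andP[vx xw] Ux; apply/slotP; split=> //.
    by apply/andP; split; lra.
  by have := phi_homo Is (ltW vx); have := phi_homo Is xw; lra.
apply: (finite_length_sub mS _ (finite_length_itv t u false false)).
by move=> x [].
Qed.

Lemma len_slot_sub s k l : inv s -> finite_length (slot td s k l).
Proof.
move=> Is; apply: (finite_length_sub (measurable_slot k l Is) _ (finite_length_itv 0 T true false)).
by move=> t; rewrite slotE => -[[]].
Qed.

(** Contraction is constant only on the window: it flattens just the packets inside, remains
    strictly increasing off the window, and slows the clock by the length of the slot. *)
Lemma inv_next s k l : inv s -> abar s k < dbar s l -> 0 <= abar s k ->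
  inv (next_state td s k l).
Proof.
move=> Is; set a := abar s k; set d := dbar s l => ad a0.
have adw := ltW ad.
have mU := measurable_used Is; have mS := measurable_slot k l Is.
have abar_lt i : i \notin scheduled (next_state td s k l) ->
    abar s i < dbar s i /\ ~ (a <= abar s i /\ dbar s i <= d).
  rewrite /= !inE negb_or => /andP[iK]; rewrite iK /= => /asboolPn ni.
  split; first exact: unscheduled_lt.
  move=> [ai id]; apply: ni => t /=; rewrite /window /= !in_itv /= -/a -/d => /andP[? ?].
  by apply/andP; split; lra.
split=> /=.
- move=> t u tu; have := phi_lip Is tu => h.
  have := @contract_lipschitz _ a d (phi s t) (phi s u) adw.
  by rewrite -/a -/d; lra.
- by rewrite (phi_0 Is) /Defs.contract a0.
- by move=> i /=; rewrite (abarE Is i).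
- by move=> i /=; rewrite (dbarE Is i).
- exact: measurableU.
- move=> i; rewrite !inE => /orP[/(scheduled_flat Is) -> //|/andP[iK /asboolP iw]].
  have lt := unscheduled_lt Is iK.
  have [] : window s k l (abar s i) /\ window s k l (dbar s i).
    by split; apply: iw; rewrite /= in_itv /= ?lexx ?ltW.
  rewrite /window /= !in_itv /= -/a -/d (abarE Is i) (dbarE Is i).
  by case_order.
- move=> i /abar_lt[]; rewrite /Defs.contract /= -/a -/d.
  by case_order.
- move=> t u Ut Uu t0 tu uT.
  have Ut' : ~ used s t by move=> ?; apply: Ut; left.
  have Uu' : ~ used s u by move=> ?; apply: Uu; left.
  have ptu := phi_incr Is Ut' Uu' t0 tu uT.
  have wP v : ~ (used s `|` slot td s k l) v -> 0 <= v -> v <= T ->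
      ~ (a <= phi s v /\ phi s v <= d).
    move=> Uv v0 vT [av vd]; apply: Uv.
    have [?|?] := pselect (used s v); [by left|right; split=> //].
      by rewrite v0.
    by rewrite /window /= in_itv /= av.
  have := wP u Uu (le_trans t0 (ltW tu)) uT.
  have := wP t Ut t0 (le_trans (ltW tu) uT).
  rewrite /Defs.contract -/a -/d.
  by case_order.
- move=> t u t0 tu uT.
  (* The growth lost is that of the clamped clock, which [len_slot_itv] identifies with the length
     of the slot. *)
  rewrite !contractE// -/a -/d.
  have := len_unused Is t0 tu uT.
  have := len_slot_itv Is adw t0 tu uT; rewrite -/a -/d.
  have fA : finite_length (`]t, u] `\` used s).
    apply: (finite_length_sub _ _ (finite_length_itv t u false false)).
      by apply: measurableD => //; exact: measurable_itv.
    by move=> x [].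
  rewrite (len_split fA mS) setDDl.
  suff -> : (`]t, u] `\` used s) `&` slot td s k l = `]t, u] `&` slot td s k l by lra.
  by apply/seteqP; split=> v; [case=> -[]|case=> tv Sv; split=> //; case: Sv].
Qed.

End Invariant.

(** * Loads of intervals and maximality of the critical window *)

Section Load.
Context {R : realType} {n : nat}.
Variables (B ta td : 'I_n.+1 -> R).
Hypothesis B_gt0 : forall i, 0 < B i.
Implicit Types (s : @state R n) (i k l : 'I_n.+1).

(** The end points are arbitrary reals, so loads can be bounded on intervals that are not candidate
    windows. *)
Definition load s (a d : R) : R :=
  \sum_(i | [&& i \notin scheduled s, a <= abar s i & dbar s i <= d]) B i.

(** Inclusion of intervals amounts to comparing end points because the updated life time of an
    unscheduled packet is nonempty. *)
Lemma mem_inside s k l i : inv ta td s -> i \in inside s k l =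
  [&& i \notin scheduled s, abar s k <= abar s i & dbar s i <= dbar s l].
Proof.
move=> Is; rewrite inE; case: (boolP (i \in scheduled s)) => //= iK.
apply/asboolP/andP => [sub|[ki il] t /=]; last first.
  rewrite /window /=.
  by rewrite !in_itv /= => /andP[it ti]; rewrite (le_trans ki it) (le_trans ti il).
have ad := ltW (unscheduled_lt Is iK).
have := sub (abar s i); have := sub (dbar s i).
rewrite /window /= !in_itv /= !lexx ad /= => /(_ isT) /andP[_ ->] /(_ isT) /andP[-> _].
by [].
Qed.

Lemma sum_inside s k l : inv ta td s ->
  \sum_(i in inside s k l) B i = load s (abar s k) (dbar s l).
Proof. by move=> Is; apply: eq_bigl => i; rewrite (mem_inside _ _ _ Is). Qed.

Lemma intensity_gt0 s k l : candidate s k l -> 0 < intensity B s k l.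
Proof.
case/and4P => _ _ kl /set0Pn[i iH]; apply: divr_gt0; last by rewrite subr_gt0.
by rewrite (bigD1 i) //= ltr_wpDr// sumr_ge0// => j _; exact: ltW.
Qed.

Lemma load_critical s k l : inv ta td s -> candidate s k l ->
  load s (abar s k) (dbar s l) = intensity B s k l * (dbar s l - abar s k).
Proof.
move=> Is /and4P[_ _ kl _]; rewrite -sum_inside// /intensity mulfVK//.
by rewrite subr_eq0 gt_eqF.
Qed.

(** Shrinking [[a, d]] to the earliest arrival and the latest deadline among the packets counted
    yields a candidate window with the same packets, whose intensity is at most the critical one. *)
Lemma load_le s k l a d : inv ta td s -> critical B s k l -> a <= d ->
  load s a d <= intensity B s k l * (d - a).
Proof.
move=> Is [ckl maxkl] ad; have rho0 := ltW (intensity_gt0 ckl).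
pose P i := [&& i \notin scheduled s, a <= abar s i & dbar s i <= d].
have [i0 Pi0|P0] := pickP P; last first.
  by rewrite /load big_pred0// mulr_ge0// subr_ge0.
have [k' Pk' mink'] := arg_minP (abar s) Pi0.
have [l' Pl' maxl'] := arg_maxP (dbar s) Pi0.
have /and3P[k'K ak' k'd] := Pk'; have /and3P[l'K al' l'd] := Pl'.
have /and3P[i0K ai0 i0d] := Pi0.
have kl' : abar s k' < dbar s l'.
  by apply: le_lt_trans (mink' _ Pi0) (lt_le_trans (unscheduled_lt Is i0K) (maxl' _ Pi0)).
have PE : P =1 (fun i => i \in inside s k' l').
  move=> i; rewrite (mem_inside _ _ _ Is); apply/idP/and3P => [Pi|[iK k'i il']].
    by have /and3P[iK _ _] := Pi; split=> //; [exact: mink'|exact: maxl'].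
  by rewrite /P iK (le_trans ak' k'i) (le_trans il' l'd).
have c' : candidate s k' l'.
  by apply/and4P; split=> //; apply/set0Pn; exists i0; rewrite -PE.
rewrite /load (eq_bigl _ _ PE) sum_inside// load_critical//.
have := maxkl _ _ c' => le_int.
apply: (@le_trans _ _ (intensity B s k l * (dbar s l' - abar s k'))).
  by apply: ler_wpM2r => //; rewrite subr_ge0 ltW.
by apply: ler_wpM2l => //; lra.
Qed.

Lemma le_load (s s' : @state R n) a d a' d' :
  (forall i, i \notin scheduled s -> a <= abar s i -> dbar s i <= d ->
    [/\ i \notin scheduled s', a' <= abar s' i & dbar s' i <= d']) ->
  load s a d <= load s' a' d'.
Proof.
move=> H; rewrite /load big_mkcond [leRHS]big_mkcond /=.
apply: ler_sum => i _; case: ifP => [/and3P[h1 h2 h3]|_].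
  by have [-> -> ->] := H i h1 h2 h3.
by case: ifP => // _; exact: ltW.
Qed.

(* Adding the critical window back to a window that touches the contraction
   point gives a window of the previous state, whose load is known. *)
Lemma load_next_le s k l a d : inv ta td s -> critical B s k l -> a <= d ->
  load (next_state td s k l) a d <= intensity B s k l * (d - a).
Proof.
move=> Is ckl ad; have [ck _] := ckl; have /and4P[_ _ kl _] := ck.
set al := abar s k in kl *; set de := dbar s l in kl *.
have lo x : x - (de - al) <= Defs.contract al de x by case_order.
have hi x : Defs.contract al de x <= x by case_order.
have unK i : i \notin scheduled (next_state td s k l) ->
    (i \notin scheduled s) && (i \notin inside s k l).
  by rewrite inE negb_or.
(* Left of the contraction point nothing has moved. *)
have [da|ad'] := ltP d al.
  apply: le_trans (load_le Is ckl ad); apply: le_load => i /unK/andP[iK _] /= ai di.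
  split=> //; first exact: le_trans ai (hi _).
  by move: di; rewrite -/al -/de; case_order.
(* Right of it, the shift by [de - al] is undone. *)
have [la|aa] := ltP al a.
  have -> : d - a = (d + (de - al)) - (a + (de - al)) by ring.
  apply: le_trans (load_le Is ckl _); last by lra.
  apply: le_load => i /unK/andP[iK _] /=; rewrite -/al -/de => ai di; split=> //.
    by move: ai; case_order.
  by have := lo (dbar s i); lra.
have := @load_le s k l a (d + (de - al)) Is ckl.
have -> : intensity B s k l * (d + (de - al) - a) =
    intensity B s k l * (d - a) + intensity B s k l * (de - al) by ring.
rewrite -load_critical// -sum_inside// -/al -/de => h.
rewrite -(lerD2r (\sum_(i in inside s k l) B i)).
apply: le_trans (h _); last by lra.
rewrite /load big_mkcond /= [X in _ + X]big_mkcond -big_split /= [leRHS]big_mkcond /=.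
apply: ler_sum => i _.
have B0 := ltW (B_gt0 i).
case: (boolP (i \in inside s k l)) => iH.
  have := iH; rewrite (mem_inside _ _ _ Is) -/al -/de => /and3P[iK ai di].
  rewrite inE iH orbT /= add0r iK /= ifT//.
  by apply/andP; split; lra.
rewrite inE (negbTE iH) orbF addr0; case: ifP => [/and3P[iK ai di]|_]; last by case: ifP.
rewrite iK ifT//=; move: ai di; rewrite /= -/al -/de => ai di.
by apply/andP; split; [exact: le_trans ai (hi _)|have := lo (dbar s i); lra].
Qed.

(** The life time of any unscheduled packet is a candidate, and there are finitely many
    candidates. *)
Lemma exists_critical s : inv ta td s -> scheduled s <> [set: 'I_n.+1] ->
  exists k l, critical B s k l.
Proof.
move=> Is Ks.
have [i iK] : exists i, i \notin scheduled s.
  apply/existsP; rewrite -negb_forall; apply/negP => /forallP h; apply: Ks.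
  by apply/setP => i; rewrite inE h.
have ci : candidate s i i.
  have ad := unscheduled_lt Is iK; apply/and4P; split=> //.
  by apply/set0Pn; exists i; rewrite (mem_inside _ _ _ Is) iK !lexx.
pose P (p : 'I_n.+1 * 'I_n.+1) := candidate s p.1 p.2.
have [[k l] /= ckl h] := @arg_maxP _ _ _ (i, i) P (fun p => intensity B s p.1 p.2) ci.
by exists k, l; split=> // k' l' c'; exact: (h (k', l')).
Qed.

Lemma card_scheduled_next s k l : candidate s k l ->
  (#|scheduled s| < #|scheduled (next_state td s k l)|)%N.
Proof.
case/and4P => _ _ _ /set0Pn[i]; rewrite inE => /andP[iK iw].
apply: proper_card; apply/properP; split; first exact: finset.subsetUl.
by exists i => //; rewrite /= !inE iK iw orbT.
Qed.

End Load.

(** * Earliest deadline first within the slot of one round *)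

Section EarliestDeadlineFirst.
Context {R : realType} {n : nat}.
Variables (B ta td r : 'I_n.+1 -> R) (x : R -> option 'I_n.+1).
Variables (s : @state R n) (k l : 'I_n.+1).
Hypothesis B_gt0 : forall i, 0 < B i.
Hypothesis ta_ge0 : forall i, 0 <= ta i.
Hypothesis ta_lt_td : forall i, ta i < td i.
Hypothesis Is : inv ta td s.
Hypothesis mx : forall i, measurable [set t | x t = Some i]%classic.
Hypothesis spec : round_spec B ta td r x s k l.
Local Open Scope classical_set_scope.

Let rho := intensity B s k l.
Let S := slot td s k l.

Definition served i : set R := slot td s k l `&` [set t | x t = Some i].

Let ckl : candidate s k l. Proof. by case: spec => -[]. Qed.

Let rho_gt0 : 0 < rho. Proof. exact: intensity_gt0 ckl. Qed.

Let alpha_ge0 : 0 <= abar s k.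
Proof. exact: abar_ge0 Is. Qed.

Let alpha_lt_delta : abar s k < dbar s l. Proof. by case/and4P: ckl. Qed.

Let slot_bounds t : S t -> 0 <= t <= horizon td. Proof. by case. Qed.

Lemma finite_served i : finite_length (served i).
Proof.
apply: (finite_length_sub _ _ (len_slot_sub k l Is)); last by move=> t [].
by apply: measurableI; [exact: measurable_slot Is|exact: mx].
Qed.

Lemma sentE i t : sent B td x s k l i t = rho * len (served i `&` `]-oo, t]).
Proof.
rewrite /sent /len /rho; do 3 f_equal; apply/seteqP; split=> u /=; rewrite in_itv /=.
  by case=> Su [ut xu].
by case=> -[Su xu] ut.
Qed.

Lemma finite_served_itv i t : finite_length (served i `&` `]-oo, t]).
Proof.
apply: (finite_length_sub _ _ (finite_served i)); last by move=> u [].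
by apply: measurableI; [exact: (finite_served i).1|exact: measurable_itv].
Qed.

Lemma sent_homo i t u : t <= u -> sent B td x s k l i t <= sent B td x s k l i u.
Proof.
move=> tu; rewrite !sentE ler_pM2l//; apply: le_len.
- exact: (finite_served_itv i t).1.
- by move=> v /= [Av]; rewrite !in_itv /= => vt; split=> //; exact: le_trans tu.
- exact: finite_served_itv.
Qed.

Lemma sent_le_served i t : sent B td x s k l i t <= rho * len (served i).
Proof.
rewrite sentE ler_pM2l//; apply: le_len.
- exact: (finite_served_itv i t).1.
- by move=> v [].
- exact: finite_served.
Qed.

Lemma served_eligible i t : served i t ->
  eligible B ta td x s k l i t /\
  forall i', eligible B ta td x s k l i' t -> td i <= td i'.
Proof.
by case=> St xt; have [_ _ /(_ t St)] := spec; rewrite xt.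
Qed.

(** If the service time exceeded [B i / rho] by [e > 0], take an instant of service within [e] of
    the last one (as a supremum). The packet is still unfinished there, and the remaining time is
    shorter than the excess. *)
Lemma served_le i : rho * len (served i) <= B i.
Proof.
rewrite leNgt; apply/negP => lt_B.
have [t0 At0] : served i !=set0.
  apply/set0P/eqP => A0; move: lt_B; rewrite A0 len0 mulr0.
  by rewrite ltNge (ltW (B_gt0 i)).
have hA : has_sup (served i).
  by split; [exists t0|exists (horizon td) => t [/slot_bounds/andP[]]].
pose e := len (served i) - B i / rho.
have e0 : 0 < e by rewrite subr_gt0 ltr_pdivrMr// mulrC.
have [t At tsup] := sup_adherent e0 hA.
have [[_ _ ]] := served_eligible At.
rewrite sentE -ltr_pdivlMl// => lt_t _.
have tle : t <= sup (served i) by apply: ub_le_sup => //; case: hA.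
have : len (served i) <= len (served i `&` `]-oo, t]) + len `]t, sup (served i)].
  apply: len_subU; [exact: (finite_served i).1|exact: finite_served_itv| |].
    exact: finite_length_itv.
  move=> v Av; have [vt|tv] := leP v t; [left|right]; rewrite /= ?in_itv//=.
  by rewrite tv /=; apply: ub_le_sup => //; case: hA.
by rewrite len_itv//; move: lt_t tsup; rewrite /e mulrC; lra.
Qed.

(* The packets of Q are those due by the deadline of i that arrive after the
   start t0 of the busy period; W is the part of that period lost to others. *)
Let no_overload i (t0 : R) (Q : pred 'I_n.+1) (W : set R) :
  i \in inside s k l -> 0 <= t0 -> t0 <= td i ->
  (forall p, Q p -> [/\ p \in inside s k l, td p <= td i &
     clamp (abar s k) (dbar s l) (phi s t0) <= abar s p]) ->
  Q i -> finite_length W -> len W < B i / rho - len (served i) ->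
  (forall v, (`]t0, td i] `&` S) v -> W v \/ exists2 p, Q p & x v = Some p) ->
  False.
Proof.
move=> iH t00 t0D QP Qi fW W_lt cov.
set c := clamp _ _ _ in QP.
have DT := le_horizon td i.
have := iH; rewrite (mem_inside _ _ _ Is) => /and3P[iK ki il].
have tdi := ltW (ta_lt_td i).
have phiD : clamp (abar s k) (dbar s l) (phi s (td i)) = dbar s i.
  by rewrite -(dbarE Is); have := unscheduled_lt Is iK; case_order.
have cD : c <= dbar s i.
  by rewrite -phiD; apply: clamp_homo; exact: phi_homo Is t0D.
have lenE := len_slot_itv Is (ltW alpha_lt_delta) t00 t0D DT.
rewrite phiD -/c in lenE.
pose E := `]t0, td i] `&` S.
have fE : finite_length E.
  apply: (finite_length_sub _ _ (len_slot_sub k l Is)); last by move=> v [].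
  by apply: measurableI; [exact: measurable_itv|exact: measurable_slot Is].
have h1 := len_split fE fW.1.
have h2 : len (E `&` W) <= len W.
  by apply: (le_len _ _ fW); [exact: measurableI fE.1 fW.1|move=> v []].
(* Off [W], the busy period consists of service to packets of [Q]. *)
have h3 : len (E `\` W) <= \sum_(p | Q p) len (served p).
  rewrite -big_filter; apply: len_cover.
  - by apply: (finite_length_sub _ _ fE); [exact: measurableD fE.1 fW.1|move=> v []].
  - by move=> p _; exact: finite_served.
  - move=> v [Ev Wv]; have [//|[p Qp xv]] := cov v Ev.
    by exists p; [rewrite mem_filter Qp mem_index_enum|split=> //; case: Ev].
(* No packet of [Q] gets more than its size, and [i] falls short by its deficit, which exceeds the
   loss [W]. *)
have h4 : rho * \sum_(p | Q p) len (served p) <=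
    \sum_(p | Q p) B p - rho * (B i / rho - len (served i)).
  rewrite (bigD1 i)// [X in _ <= X - _](bigD1 i)//= mulrDr mulr_sumr.
  rewrite mulrBr mulrCA divff ?gt_eqF// mulr1.
  have : \sum_(p | Q p && (p != i)) rho * len (served p) <=
         \sum_(p | Q p && (p != i)) B p by apply: ler_sum => p _; exact: served_le.
  by lra.
(* The packets of [Q] have their updated life times in [[c, dbar s i]], whose load is bounded by
   criticality. *)
have h5 : \sum_(p | Q p) B p <= rho * (dbar s i - c).
  have [crit _ _] := spec.
  apply: le_trans (load_le B_gt0 Is crit cD).
  rewrite /load big_mkcond [leRHS]big_mkcond /=; apply: ler_sum => p _.
  case: ifP => [/QP[pH pi cp]|_]; last by case: ifP => // _; exact: ltW.
  rewrite ifT//; have := pH; rewrite (mem_inside _ _ _ Is) => /and3P[-> _ _].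
  by rewrite cp /= !(dbarE Is) (phi_homo Is).
have h6 : rho * (dbar s i - c) <= rho * (len W + \sum_(p | Q p) len (served p)).
  by rewrite ler_pM2l// -lenE -/S -/E h1; lra.
have h7 : rho * len W < rho * (B i / rho - len (served i)) by rewrite ltr_pM2l.
by move: h6; rewrite mulrDr; lra.
Qed.

(** An unfinished [i] is eligible throughout its life time, so there the slot only serves packets
    due by [td i]. Extending this period back to the last exception gives the busy period refuted by
    [no_overload]. *)
Lemma served_ge i : i \in inside s k l -> B i <= rho * len (served i).
Proof.
move=> iH; rewrite leNgt; apply/negP => lt_B.
have eta : 0 < B i / rho - len (served i) by rewrite subr_gt0 ltr_pdivlMr// mulrC.
have i_elig t : ta i <= t -> t <= td i -> eligible B ta td x s k l i t.
  by move=> it ti; split=> //; [rewrite it|exact: le_lt_trans (sent_le_served i t) lt_B].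
pose P p := (p \in inside s k l) && (td p <= td i).
have busy v : S v -> ta i <= v -> v <= td i -> exists2 p, P p & x v = Some p.
  move=> Sv iv vi; have [_ _ /(_ v Sv)] := spec.
  case: (x v) => [p [[pH _ _] /(_ i (i_elig v iv vi)) pi]|/(_ i)]; last first.
    by move=> /(_ (i_elig v iv vi)).
  by exists p => //; rewrite /P pH.
(* The exceptions: slot instants before the arrival of [i] at which nothing due by [td i] is
   transmitted. If there are none, the busy period starts at 0. *)
pose Z := [set t | [/\ S t, t < ta i & forall p, P p -> x t <> Some p]].
have outZ v : S v -> v <= td i -> ~ Z v -> exists2 p, P p & x v = Some p.
  move=> Sv vi Zv; have [/busy|vlt] := leP (ta i) v; first exact.
  apply: contrapT => h; apply: Zv; split=> // p Pp xv; apply: h; by exists p.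
have [Z0|/set0P[z0 Zz0]] := eqVneq Z set0.
  apply: (@no_overload i 0 P set0) => //.
  - exact: ltW (le_lt_trans (ta_ge0 i) (ta_lt_td i)).
  - move=> p /andP[pH pi]; split=> //; rewrite (phi_0 Is) clamp_lo// ?(ltW alpha_lt_delta)//.
    by move: pH; rewrite (mem_inside _ _ _ Is) => /and3P[].
  - by rewrite /P iH lexx.
  - exact: finite_length0.
  - by rewrite len0.
  - move=> v [/=]; rewrite in_itv /= => /andP[_ vi] Sv; right.
    by apply: outZ => //; rewrite Z0.
have hZ : has_sup Z by split; [exists z0|exists (ta i) => t [_ /ltW]].
(* [sup Z] need not belong to [Z]; an element within the deficit of [i] suffices, and []t, sup Z]]
   is the loss [W]. *)
have [t Zt tsup] := sup_adherent eta hZ.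
have tle : t <= sup Z by apply: ub_le_sup => //; case: hZ.
have [St ti idle] := Zt; have /andP[t_ge0 tT] := slot_bounds St.
have tdi := ltW (ta_lt_td i).
have clampt : clamp (abar s k) (dbar s l) (phi s t) = phi s t.
  by case: St => _ _; rewrite /window /= in_itv /=; case_order.
apply: (@no_overload i t (fun p => P p && (t < ta p)) `]t, sup Z]) => //.
- exact: le_trans (ltW ti) tdi.
- move=> p /andP[/andP[pH pi] tp]; split=> //.
  by rewrite clampt (abarE Is) (phi_homo Is)// ltW.
- by rewrite /P iH lexx ti.
- exact: finite_length_itv.
- by rewrite len_itv//; lra.
- move=> v [/=]; rewrite in_itv /= => /andP[tv vi] Sv.
  have [Zv|Zv] := pselect (Z v).
    by left; rewrite in_itv /= tv; apply: ub_le_sup => //; case: hZ.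
  right; have [p Pp xv] := outZ v Sv vi Zv; exists p => //.
  rewrite Pp ltNge; apply/negP => pt.
  (* A packet [p] served at [v] cannot have arrived by [t]: it would be eligible at [t], so a packet
     due by [td p <= td i] would be transmitted at [t], against [t] being in [Z]. *)
  have [[pH /andP[_ vp] sp] _] := served_eligible (conj Sv xv : served p v).
  have pe : eligible B ta td x s k l p t.
    split=> //; first by rewrite pt (le_trans (ltW tv) vp).
    exact: le_lt_trans (sent_homo p (ltW tv)) sp.
  have [_ _ /(_ t St)] := spec; case E : (x t) => [q|]; last by move=> /(_ p).
  case=> -[qH _ _] /(_ p pe) qp; apply: (idle q) => //.
  by rewrite /P qH (le_trans qp)//; case/andP: Pp.
Qed.

Lemma len_served i : i \in inside s k l -> len (served i) = B i / rho.
Proof.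
move=> iH; have -> : B i = rho * len (served i).
  by apply/le_anti; rewrite served_ge ?served_le.
by rewrite mulrAC divff ?mul1r// gt_eqF.
Qed.

End EarliestDeadlineFirst.

(** * A measurable earliest-deadline-first assignment *)

Section Greedy.
Context {R : realType} {n : nat}.
Variables (B ta td : 'I_n.+1 -> R) (rho : R).
Hypothesis rho_gt0 : 0 < rho.
Local Open Scope classical_set_scope.
Implicit Types (U : set R) (x : R -> option 'I_n.+1) (ps : seq 'I_n.+1).

Let amount U p t := len (U `&` `[ta p, t]).

Let finite_amount U p t : measurable U -> finite_length (U `&` `[ta p, t]).
Proof.
move=> mU; apply: (finite_length_sub _ _ (finite_length_itv (ta p) t true false)).
  by apply: measurableI => //; exact: measurable_itv.
by move=> v [].
Qed.

Let amount_lip U p : measurable U ->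
  forall t u, t <= u -> 0 <= amount U p u - amount U p t <= u - t.
Proof.
move=> mU t u tu; rewrite subr_ge0; apply/andP; split.
  apply: (le_len _ _ (finite_amount p u mU)); first exact: (finite_amount p t mU).1.
  move=> v [Uv /=]; rewrite !in_itv /= => /andP[av vt]; split=> //.
  by rewrite av (le_trans vt).
rewrite lerBlDl -(len_itv false false tu); apply: len_subU.
- exact: (finite_amount p u mU).1.
- exact: finite_amount.
- exact: finite_length_itv.
- move=> v [Uv /=]; rewrite in_itv /= => /andP[av vu].
  have [vt|tv] := leP v t; first by left; split; rewrite //= in_itv /= av.
  by right; rewrite /= in_itv /= tv.
Qed.

(** [U] is the free time; the share of [p] stops when the free time elapsed since [ta p] suffices at
    rate [rho]. *)
Definition first_fit U p : set R :=
  [set t | [/\ U t, ta p <= t <= td p & rho * len (U `&` `[ta p, t]) < B p]].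

Lemma measurable_first_fit U p : measurable U -> measurable (first_fit U p).
Proof.
move=> mU.
rewrite (_ : first_fit U p =
    (U `&` `[ta p, td p]) `&` amount U p @^-1` `]-oo, B p / rho[).
  apply: measurableI.
    by apply: measurableI => //; exact: measurable_itv.
  apply: measurable_lipschitz_preimage (amount_lip p mU) _.
  exact: measurable_itv.
apply/seteqP; split=> t /=; rewrite /first_fit /= !in_itv /= ltr_pdivlMr// mulrC.
  by case.
by case=> -[].
Qed.

(** The free time elapsed since [ta p] is continuous in its end point. Were the share [L] below
    [B p / rho], that elapsed time would take a value strictly between at some [v <= t]; but all
    free time from [ta p] up to [v] belongs to the share. *)
Lemma first_fit_full U p t : measurable U -> U t -> ta p <= t <= td p ->
  ~ first_fit U p t -> B p <= rho * len (first_fit U p `&` `]-oo, t]).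
Proof.
move=> mU Ut /andP[pt tp] nft.
have full : B p / rho <= amount U p t.
  rewrite ler_pdivrMr// mulrC leNgt; apply/negP => lt_B; apply: nft.
  by split=> //; rewrite pt.
rewrite mulrC -ler_pdivrMr//; set L := len _; rewrite leNgt; apply/negP => ltL.
have L0 : 0 <= L by exact: len_ge0.
have am0 : amount U p (ta p) = 0.
  apply: (len_subset0 _ _ (finite_length_set1 (ta p)) (len_set1 _)).
    exact: (finite_amount p (ta p) mU).1.
  by move=> v [_ /=]; rewrite in_itv /= => /le_anti.
have [||v /andP[pv vt] vE] := lipschitz_IVT (c := (L + B p / rho) / 2) (amount_lip p mU) pt.
- by rewrite am0; lra.
- by lra.
suff : amount U p v <= L by rewrite vE; lra.
apply: le_len.
- exact: (finite_amount p v mU).1.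
- move=> w [Uw /=]; rewrite in_itv /= => /andP[pw wv]; split; last first.
    by rewrite /= in_itv /= (le_trans wv).
  split=> //; first by rewrite pw (le_trans wv)// (le_trans vt).
  rewrite mulrC -ltr_pdivlMr//; have := amount_lip p mU wv.
  by rewrite vE /amount; lra.
- apply: (finite_length_sub _ _ (finite_amount p t mU)).
    apply: measurableI; first exact: measurable_first_fit.
    exact: measurable_itv.
  by move=> w [[Uw /andP[pw _] _] /=]; rewrite !in_itv /= pw.
Qed.

Fixpoint greedy U ps : R -> option 'I_n.+1 :=
  if ps is p :: ps' then fun t =>
    if `[< first_fit U p t >] then Some p else greedy (U `\` first_fit U p) ps' t
  else fun=> None.

(** The counterpart of [eligible] for an arbitrary free set; membership among the packets of the
    round is kept apart for the induction on the list. *)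
Definition pending U x p t : Prop :=
  ta p <= t <= td p /\ rho * len (U `&` [set u | u <= t /\ x u = Some p]) < B p.

Lemma greedy_mem U ps t i : greedy U ps t = Some i -> i \in ps /\ U t.
Proof.
elim: ps U => [//|p ps IH] U /=; case: asboolP => [[Ut _ _] [<-]|_ /IH[ips []]].
  by rewrite mem_head.
by rewrite inE ips orbT.
Qed.

Lemma measurable_greedy U ps i : measurable U ->
  measurable [set t | greedy U ps t = Some i].
Proof.
elim: ps U => [|p ps IH] U mU /=.
  by rewrite (_ : [set _ | _] = set0)//; apply/seteqP; split.
have mf := measurable_first_fit p mU.
have mIH := IH _ (measurableD mU mf).
rewrite (_ : [set t | _] = (first_fit U p `&` [set t | p = i]) `|`
  ([set t | greedy (U `\` first_fit U p) ps t = Some i] `\` first_fit U p)).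
  apply: measurableU; last exact: measurableD.
  apply: measurableI => //; have [->|pi] := eqVneq p i.
    by rewrite (_ : [set _ | _] = setT)//; apply/seteqP; split.
  by rewrite (_ : [set _ | _] = set0)//; apply/seteqP; split=> // t /= /eqP; rewrite (negbTE pi).
apply/seteqP; split=> t /=; case: asboolP => ft.
- by case=> pi; left.
- by right.
- by case=> [[_ ->//]|[_ /(_ ft)]].
- by case=> [[/ft]|[]].
Qed.

(** Induction on the list. The head has the smallest deadline, so it may be served whenever it takes
    its share; at any other free instant it is not pending, by [first_fit_full]. The tail sees the
    problem with the share of the head removed. *)
Lemma greedy_spec U ps : measurable U -> uniq ps ->
  sorted (relpre td <=%R) ps ->
  forall t, U t -> match greedy U ps t with
    | Some i => pending U (greedy U ps) i t /\
        forall i', i' \in ps -> pending U (greedy U ps) i' t -> td i <= td i'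
    | None => forall i, i \in ps -> ~ pending U (greedy U ps) i t
    end.
Proof.
elim: ps U => [//|p ps IH] U mU /andP[pps ups] sps t Ut.
have mf := measurable_first_fit p mU.
set x := greedy U (p :: ps); pose U' := U `\` first_fit U p.
have xE v : x v = if `[< first_fit U p v >] then Some p else greedy U' ps v by [].
have x_p : U `&` [set v | x v = Some p] = first_fit U p.
  apply/seteqP; split=> v /=; rewrite xE; case: asboolP => // fv.
    by case=> _ /greedy_mem[]; rewrite (negbTE pps).
  by move=> _; split=> //; case: fv.
have x_i i : i \in ps -> U `&` [set v | x v = Some i] =
    U' `&` [set v | greedy U' ps v = Some i].
  move=> ips; apply/seteqP; split=> v /=; rewrite xE.
    case: asboolP => fv [Uv]; last by split.
    by case=> pi; move: pps; rewrite pi ips.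
  by case=> -[Uv fv] gv; split=> //; case: asboolP.
(* The share of the head never counts for another packet, so removing it leaves their status
   unchanged. *)
have pend_i i v : i \in ps -> pending U x i v <-> pending U' (greedy U' ps) i v.
  move=> ips; rewrite /pending.
  have cut (V : set R) y : V `&` [set u | u <= v /\ y u = Some i] =
      (V `&` [set u | y u = Some i]) `&` [set u | u <= v].
    by apply/seteqP; split=> u; [case=> ? []|case=> -[]].
  by rewrite !cut x_i.
have pend_p v : pending U x p v <-> ta p <= v <= td p /\
    rho * len (first_fit U p `&` `]-oo, v]) < B p.
  rewrite /pending -x_p; suff -> : U `&` [set u | u <= v /\ x u = Some p] =
      (U `&` [set u | x u = Some p]) `&` `]-oo, v] by [].
  apply/seteqP; split=> u /=; rewrite in_itv /=; first by case=> ? [].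
  by case=> -[].
have td_min i : i \in ps -> td p <= td i.
  move=> ips; have : path (relpre td <=%R) p ps by [].
  rewrite path_sortedE; last by move=> a b c /=; exact: le_trans.
  by case/andP => /allP /(_ i ips).
rewrite xE; case: asboolP => ft.
  split; last first.
    by move=> i'; rewrite inE => /orP[/eqP->//|/td_min].
  have [_ pt lt_B] := ft; apply/pend_p; split=> //; apply: le_lt_trans lt_B.
  rewrite ler_pM2l//; apply: (le_len _ _ (finite_amount p t mU)).
    by apply: measurableI => //; exact: measurable_itv.
  move=> v [[Uv /andP[pv _] _] /=]; rewrite in_itv /= => vt; split=> //.
  by rewrite /= in_itv /= pv.
have np : ~ pending U x p t.
  by move=> /pend_p[pt]; rewrite ltNge first_fit_full.
have := IH U' (measurableD mU mf) ups (path_sorted sps) t (conj Ut ft).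
case E : (greedy U' ps t) => [i|] H.
  have [ips _] := greedy_mem E; have [Hi Hmin] := H; split; first exact/pend_i.
  move=> i'; rewrite inE => /orP[/eqP-> /np//|i'ps /pend_i Hi'].
  by apply: Hmin => //; exact: Hi'.
by move=> i; rewrite inE => /orP[/eqP->//|ips] /(pend_i _ _ ips); exact: H.
Qed.

End Greedy.

(** * Existence of a run *)

Section Existence.
Context {R : realType} {n : nat}.
Variables (B ta td : 'I_n.+1 -> R).
Hypothesis B_gt0 : forall i, 0 < B i.
Hypothesis ta_ge0 : forall i, 0 <= ta i.
Local Open Scope classical_set_scope.

Lemma round_spec_ext (r r' : 'I_n.+1 -> R) (x x' : R -> option 'I_n.+1) s k l :
  (forall i, i \in inside s k l -> r i = r' i) ->
  (forall t, slot td s k l t -> x t = x' t) ->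
  round_spec B ta td r x s k l -> round_spec B ta td r' x' s k l.
Proof.
move=> rr' xx' [crit rE xE].
have sE i t : sent B td x s k l i t = sent B td x' s k l i t.
  rewrite /sent; do 3 f_equal; apply/seteqP; split=> u [Su [ut xu]]; do 2 split=> //.
    by rewrite -xx'.
  by rewrite xx'.
have eE i t : eligible B ta td x s k l i t <-> eligible B ta td x' s k l i t.
  by rewrite /eligible sE.
split=> // [i iH|t St]; first by rewrite -rr'// rE.
rewrite -xx'//; have := xE t St; case: (x t) => [i [/eE ei emin]|e i /eE//].
  by split=> // i' /eE; exact: emin.
exact: e.
Qed.

(** A run never reads the rates of packets already scheduled nor the transmissions in used time, so
    a round can be glued in front of it. *)
Lemma run_ext (r r' : 'I_n.+1 -> R) (x x' : R -> option 'I_n.+1) s :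
  run B ta td r x s ->
  (forall i, i \notin scheduled s -> r i = r' i) ->
  (forall t, ~ used s t -> x t = x' t) -> run B ta td r' x' s.
Proof.
move=> rs; elim: rs => {}s k l sp K1 => [idle|_ IH] rr' xx'.
- apply: (run_stop (k := k) (l := l)) => //.
    apply: round_spec_ext sp => [i|t [_ Ut _]]; last exact: xx'.
    by rewrite inE => /andP[/rr'].
  by move=> t Ut; rewrite -xx' ?idle// => Us; apply: Ut; left.
- apply: (run_next (k := k) (l := l)) => //.
    apply: round_spec_ext sp => [i|t [_ Ut _]]; last exact: xx'.
    by rewrite inE => /andP[/rr'].
  apply: IH => [i|t Ut].
    by rewrite /= inE negb_or => /andP[/rr'].
  by apply: xx' => Us; apply: Ut; left.
Qed.

(** Induction on the number of unscheduled packets, which each round decreases; the greedy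
    assignment on the slot fulfils the round. *)
Lemma exists_run s : inv ta td s -> scheduled s <> [set: 'I_n.+1]%SET ->
  exists r x, (forall i, measurable [set t | x t = Some i]) /\ run B ta td r x s.
Proof.
have [N] := ubnP (n.+1 - #|scheduled s|)%N; elim: N s => // N IH s sN Is Ks.
have [k [l crit]] := exists_critical B Is Ks; have [ckl _] := crit.
set rho := intensity B s k l; have rho0 : 0 < rho by exact: intensity_gt0.
pose ps := sort (relpre td <=%R) (enum (inside s k l)).
have psE i : (i \in ps) = (i \in inside s k l) by rewrite mem_sort mem_enum.
have psu : uniq ps by rewrite sort_uniq enum_uniq.
have pss : sorted (relpre td <=%R) ps.
  by apply: sort_sorted => a b /=; exact: le_total.
have mS := measurable_slot k l Is; set S := slot td s k l in mS *.
pose xs := greedy B ta td rho S ps.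
have mxs i : measurable [set t | xs t = Some i] by exact: measurable_greedy.
have sp0 : round_spec B ta td (fun=> rho) xs s k l.
  split=> // t St; have := greedy_spec B ta rho0 mS psu pss St.
  rewrite -/xs; case E : (xs t) => [i|] H; last first.
    by move=> i [iH it si]; apply: (H i); rewrite ?psE.
  have [ips _] := greedy_mem E; have [[it si] imin] := H.
  split; first by split=> //; rewrite -psE.
  by move=> i' [iH' it' si']; apply: imin; rewrite ?psE.
have [K1|K1] := eqVneq (scheduled (next_state td s k l)) [set: 'I_n.+1]%SET.
  exists (fun=> rho), xs; split=> //; apply: run_stop sp0 K1 _ => t Ut.
  case E : (xs t) => [i|//]; have [_ St] := greedy_mem E.
  by exfalso; apply: Ut; right.
have /and4P[_ _ kl _] := ckl.
have a0 := abar_ge0 k ta_ge0 Is.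
have lt_card := card_scheduled_next td ckl.
have Kle : (#|scheduled (next_state td s k l)| <= n.+1)%N.
  by rewrite -[leqRHS]card_ord max_card.
have [||r' [x' [mx' run']]] := IH _ _ (inv_next Is kl a0); last first.
(* The greedy round governs its own slot and packets, the later run everything else. *)
- pose r i := if i \in inside s k l then rho else r' i.
  pose x t := if `[< S t >] then xs t else x' t.
  exists r, x; split=> [i|].
    rewrite (_ : [set t | _] = (S `&` [set t | xs t = Some i]) `|`
        ([set t | x' t = Some i] `\` S)).
      by apply: measurableU; [exact: measurableI|exact: measurableD].
    apply/seteqP; split=> t /=; rewrite /x; case: asboolP => St.
    + by left.
    + by right.
    + by case=> -[].
    + by case=> -[].
  apply: (run_next (k := k) (l := l)).
  + apply: round_spec_ext sp0 => [i iH|t St]; first by rewrite /r iH.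
    by rewrite /x; case: asboolP.
  + exact/eqP.
  + apply: run_ext run' _ _ => [i|t Ut].
      by rewrite /= !inE negb_or /r inE => /andP[_ /negbTE ->].
    by rewrite /x; case: asboolP => // St; exfalso; apply: Ut; right.
- exact/eqP.
- by move: sN lt_card Kle; lia.
Qed.

End Existence.

(** * Instants and epochs *)

Section Instants.
Context {R : realType} {n : nat}.
Variables (ta td : 'I_n.+1 -> R).
Hypothesis ta_0 : ta ord0 = 0.
Hypothesis ta_ge0 : forall i, 0 <= ta i.
Hypothesis ta_lt_td : forall i, ta i < td i.
Local Notation M := (nb_epochs ta td).
Local Notation t_ := (instant ta td).

Lemma mem_instants v : (v \in instants ta td) = (v \in codom ta ++ codom td).
Proof. by rewrite mem_sort mem_undup. Qed.

Lemma ta_instants i : ta i \in instants ta td.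
Proof. by rewrite mem_instants mem_cat codom_f. Qed.

Lemma td_instants i : td i \in instants ta td.
Proof. by rewrite mem_instants mem_cat codom_f orbT. Qed.

Lemma size_instants : size (instants ta td) = M.+1.
Proof. by have := ta_instants ord0; rewrite /nb_epochs; case: instants. Qed.

Lemma instant_lt (i j : nat) : (i < j)%N -> (j <= M)%N -> t_ i < t_ j.
Proof.
move=> ij jM; apply: (sorted_ltn_nth lt_trans) => //.
- by rewrite /instants sort_lt_sorted undup_uniq.
- by rewrite inE size_instants ltnS (leq_trans (ltnW ij)).
- by rewrite inE size_instants ltnS.
Qed.

Lemma instant_le (i j : nat) : (i <= j)%N -> (j <= M)%N -> t_ i <= t_ j.
Proof. by rewrite leq_eqVlt => /orP[/eqP->//|ij jM]; rewrite ltW ?instant_lt. Qed.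

Lemma instantP v : v \in instants ta td -> exists2 j, (j <= M)%N & t_ j = v.
Proof.
move=> vI; exists (index v (instants ta td)); last exact: nth_index.
by rewrite -ltnS -size_instants index_mem.
Qed.

Lemma instants_bounds v : v \in instants ta td -> 0 <= v <= horizon td.
Proof.
rewrite mem_instants mem_cat => /orP[] /codomP[i ->].
  by rewrite ta_ge0 (le_trans (ltW (ta_lt_td i)) (le_horizon td i)).
by rewrite le_horizon (le_trans (ta_ge0 i) (ltW (ta_lt_td i))).
Qed.

Lemma mem_instant j : (j <= M)%N -> t_ j \in instants ta td.
Proof. by move=> jM; rewrite mem_nth// size_instants ltnS. Qed.

Lemma instant0 : t_ 0 = 0.
Proof.
have [j jM] := instantP (ta_instants ord0); rewrite ta_0 => j0.
have /andP[h _] := instants_bounds (mem_instant (leq0n M)).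
have : t_ 0 <= 0 by rewrite -[leRHS]j0 instant_le.
by move=> h'; apply/le_anti; rewrite h h'.
Qed.

Lemma instant_last : t_ M = horizon td.
Proof.
have : horizon td \in instants ta td.
  rewrite mem_instants mem_cat; apply/orP; right.
  apply: (big_ind (fun v => v \in codom td)) => [|u v|i _]; rewrite ?codom_f//.
  by rewrite /Order.max; case: ifP.
move=> /instantP[j jM jT].
have /andP[_ h] := instants_bounds (mem_instant (leqnn M)).
have : horizon td <= t_ M by rewrite -[leLHS]jT instant_le.
by move=> h'; apply/le_anti; rewrite h h'.
Qed.

Lemma epoch_bounds (j : 'I_M) : [/\ 0 <= t_ j, t_ j < t_ j.+1 & t_ j.+1 <= horizon td].
Proof.
have /andP[h1 _] := instants_bounds (mem_instant (ltnW (ltn_ord j))).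
have /andP[_ h2] := instants_bounds (mem_instant (ltn_ord j)).
by split=> //; exact: instant_lt.
Qed.

(** No arrival or deadline falls strictly inside an epoch, so a life time either contains an epoch
    or meets it in at most one end point. *)
Lemma instant_gap (j : 'I_M) v : v \in instants ta td -> v <= t_ j \/ t_ j.+1 <= v.
Proof.
move=> /instantP[m mM <-]; have [mj|jm] := leqP m j; [left|right].
  by rewrite instant_le// ltnW.
exact: instant_le.
Qed.

Lemma telescope_epochs (g : R -> R) :
  \sum_(j < M) (g (t_ j.+1) - g (t_ j)) = g (horizon td) - g 0.
Proof.
have := telescope_sumr (fun j => g (t_ j)) (leq0n M).
by rewrite big_mkord => ->; rewrite instant_last instant0.
Qed.

Lemma mem_epochs_of i j : (j \in epochs_of ta td i) = (ta i <= t_ j) && (t_ j.+1 <= td i).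
Proof.
rewrite inE; apply/asboolP/andP => [sub|[aj jd] v].
  have [_ /ltW le _] := epoch_bounds j.
  have := sub (t_ j.+1); have := sub (t_ j); rewrite /epoch /lifetime.
  by rewrite /= !in_itv /= !lexx le => /(_ isT)/andP[-> _] /(_ isT)/andP[_ ->].
rewrite /epoch /lifetime /= !in_itv /= => /andP[jv vj].
by rewrite (le_trans aj jv) (le_trans vj jd).
Qed.

Lemma packets_epochs i j : (i \in packets_of ta td j) = (j \in epochs_of ta td i).
Proof. by rewrite !inE. Qed.

End Instants.

(** * Feasibility of the schedule, and the time any feasible schedule can give *)

Section Feasibility.
Context {R : realType} {n : nat}.
Variables (B ta td : 'I_n.+1 -> R).
Hypothesis B_gt0 : forall i, 0 < B i.
Hypothesis ta_0 : ta ord0 = 0.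
Hypothesis ta_ge0 : forall i, 0 <= ta i.
Hypothesis ta_lt_td : forall i, ta i < td i.
Local Notation t_ := (instant ta td).
Local Notation T := (horizon td).
Local Open Scope classical_set_scope.

(** Induction along the run, one [step] per round. The packets of a round get [B i / r i] in its
    slot and, being scheduled afterwards, nothing later; the slot serves no other packet. After the
    last round the transmitter is idle. *)
Lemma run_delivers r x s : (forall i, measurable [set t | x t = Some i]) ->
  run B ta td r x s -> inv ta td s -> forall i,
  (i \notin scheduled s ->
     0 < r i /\ len (~` used s `&` [set t | x t = Some i]) = B i / r i) /\
  (forall t, ~ used s t -> x t = Some i ->
     i \notin scheduled s /\ ta i <= t <= td i).
Proof.
move=> mx; suff step s' k l : round_spec B ta td r x s' k l ->
    (inv ta td (next_state td s' k l) -> forall i,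
      (i \notin scheduled (next_state td s' k l) -> 0 < r i /\
       len (~` used (next_state td s' k l) `&` [set t | x t = Some i]) = B i / r i) /\
      (forall t, ~ used (next_state td s' k l) t -> x t = Some i ->
       i \notin scheduled (next_state td s' k l) /\ ta i <= t <= td i)) ->
    inv ta td s' -> forall i,
      (i \notin scheduled s' -> 0 < r i /\
       len (~` used s' `&` [set t | x t = Some i]) = B i / r i) /\
      (forall t, ~ used s' t -> x t = Some i ->
       i \notin scheduled s' /\ ta i <= t <= td i).
  elim=> {}s k l sp K1 => [idle|_ IH]; apply: step sp _ => // _ i.
  by rewrite K1 inE; split=> // t /idle ->.
move=> sp IH Is i; have [[ckl _] rE xE] := sp; have /and4P[_ _ kl _] := ckl.
have {IH} [IH1 IH2] := IH (inv_next Is kl (abar_ge0 k ta_ge0 Is)) i.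
have in_slot t : slot td s' k l t -> x t = Some i ->
    i \in inside s' k l /\ ta i <= t <= td i.
  by move=> St xt; have := xE t St; rewrite xt => -[[]].
split=> [iK|t Ut xt]; last first.
  have [/in_slot/(_ xt)[]|St] := pselect (slot td s' k l t).
    by rewrite inE => /andP[].
  have [|] := IH2 t _ xt; first by case.
  by rewrite /= inE negb_or => /andP[].
have [iH|iH] := boolP (i \in inside s' k l).
  rewrite rE//; split; first exact: intensity_gt0 ckl.
  rewrite -(len_served B_gt0 ta_ge0 ta_lt_td Is mx sp iH); congr len.
  apply/seteqP; split=> t [Ut xt]; split=> //; last by case: Ut.
  apply: contrapT => St; have [|] := IH2 t _ xt; first by case.
  by rewrite /= inE iH orbT.
have [|r0 <-] := IH1; first by rewrite /= inE negb_or iK.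
split=> //; congr len; apply/seteqP; split=> t [Ut xt]; split=> //.
  by case=> [//|/in_slot/(_ xt)[]]; rewrite (negbTE iH).
by move=> Us; apply: Ut; left.
Qed.

(** Closed epochs overlap in end points of length zero, so the time spent on a packet telescopes
    over the epochs. *)
Lemma len_epoch_telescope (A : set R) (j : 'I_(nb_epochs ta td)) : measurable A ->
  len (epoch ta td j `&` A) =
  len (A `&` `[0, t_ j.+1]) - len (A `&` `[0, t_ j]).
Proof.
move=> mA; have [j0 /ltW jj jT] := epoch_bounds ta_ge0 ta_lt_td j.
have fA (a b : R) : finite_length (A `&` `[a, b]).
  apply: (finite_length_sub _ _ (finite_length_itv a b true false)); last by move=> v [].
  by apply: measurableI => //; exact: measurable_itv.
have mI : measurable `[0, t_ j] by exact: measurable_itv.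
rewrite (len_split (fA 0 (t_ j.+1)) mI).
have -> : (A `&` `[0, t_ j.+1]) `&` `[0, t_ j] = A `&` `[0, t_ j].
  apply/seteqP; split=> v /=; rewrite !in_itv /=; first by case=> -[].
  by case=> Av /andP[v0 vj]; rewrite v0 vj (le_trans vj jj).
rewrite addrK setIC.
have fE : finite_length (A `&` epoch ta td j) by exact: fA.
rewrite (len_split fE (measurable_set1 (t_ j))).
rewrite [X in _ + X](_ : _ = 0) ?addr0.
  congr len; apply/seteqP; split=> v /=; rewrite /epoch /= !in_itv /=.
    case=> -[Av /andP[jv vj]] /eqP nv; split.
      by rewrite (le_trans j0 jv).
    by rewrite (le_trans j0 jv) /= => vj'; apply: (negP nv); rewrite eq_le vj'.
  case=> -[Av /andP[v0 vj]]; rewrite v0 /= => /negP; rewrite -ltNge => jv.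
  by rewrite (ltW jv) vj; split=> // vE; rewrite vE ltxx in jv.
apply: (len_subset0 _ _ (finite_length_set1 (t_ j)) (len_set1 _)); last by move=> v [].
by apply: measurableI => //; exact: fE.1.
Qed.

Lemma algorithm1_feasible r tau : algorithm1 B ta td r tau ->
  feasible B ta td r tau /\ forall i, 0 < r i.
Proof.
case=> x [mx rx tauE].
have Is := inv_init ta_lt_td.
have del i : 0 < r i /\ len [set t | x t = Some i] = B i / r i.
  have [h _] := run_delivers mx rx Is i; have [|r0 <-] := h; first by rewrite inE.
  by split=> //; rewrite /= setC0 setTI.
have life i t : x t = Some i -> ta i <= t <= td i.
  by move=> xt; have [_ /(_ t)] := run_delivers mx rx Is i; case.
have r_gt0 i : 0 < r i by case: (del i).
(* By [instant_gap], transmissions of [i] meet such an epoch in at most one end point. *)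
have tau_out i j : j \notin epochs_of ta td i -> tau i j = 0.
  move=> jC; rewrite tauE; apply: len_point.
    by apply: measurableI => //; exact: measurable_itv.
  have [_ jj _] := epoch_bounds ta_ge0 ta_lt_td j.
  have eq_end (v : R) : (epoch ta td j `&` [set t | x t = Some i]) v ->
      (td i <= t_ j -> v = t_ j) /\ (t_ j.+1 <= ta i -> v = t_ j.+1).
    case; rewrite /epoch /= in_itv /= => /andP[jv vj] /life/andP[iv vi].
    by split=> h; apply/le_anti; rewrite ?jv ?vj ?(le_trans vi h) ?(le_trans h iv).
  move=> u v /eq_end[u1 u2] /eq_end[v1 v2].
  have [aj|ja] := instant_gap j (ta_instants ta td i); last by rewrite u2// v2.
  have [dj|jd] := instant_gap j (td_instants ta td i); first by rewrite u1// v1.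
  by move: jC; rewrite mem_epochs_of// aj jd.
split=> //; split=> //.
- move=> i; split; first exact: lt0r_neq0.
  have -> : \sum_(j in epochs_of ta td i) tau i j = \sum_j tau i j.
    rewrite [RHS](bigID (mem (epochs_of ta td i))) /= [X in _ = _ + X]big1 ?addr0//.
    by move=> j; exact: tau_out.
  have -> : \sum_j tau i j = len [set t | x t = Some i].
    pose m u := len ([set t | x t = Some i] `&` `[0, u]).
    transitivity (m T - m 0).
      rewrite -(telescope_epochs ta_0 ta_ge0 ta_lt_td) //; apply: eq_bigr => j _.
      by rewrite tauE -len_epoch_telescope.
    have -> : m 0 = 0.
      apply: (len_subset0 _ _ (finite_length_set1 0) (len_set1 _)).
        by apply: measurableI => //; exact: measurable_itv.
      by move=> v [_ /=]; rewrite in_itv /= => /le_anti.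
    rewrite subr0; congr len; apply/seteqP; split=> v; first by case.
    move=> xv; split=> //=; rewrite in_itv /=; have /andP[iv vi] := life i v xv.
    by rewrite (le_trans (ta_ge0 i) iv) (le_trans vi (le_horizon td i)).
  by have [_ ->] := del i; rewrite subrr.
- move=> j; rewrite subr_le0; have [_ /ltW jj _] := epoch_bounds ta_ge0 ta_lt_td j.
  (* Transmissions of distinct packets are disjoint subsets of the epoch, so [len_packing]
     applies. *)
  rewrite /epoch_length -(len_itv true false jj) -big_filter.
  rewrite (eq_bigr (fun i => len (epoch ta td j `&` [set t | x t = Some i]))).
    apply: len_packing; rewrite ?filter_uniq ?index_enum_uniq//.
    + exact: finite_length_itv.
    + by move=> i _; apply: measurableI => //; exact: measurable_itv.
    + by move=> i i' v [_ /= xi] [_ /= xi']; move: xi; rewrite xi' => -[].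
  by move=> i _; rewrite tauE.
- by move=> j i _; rewrite tauE len_ge0.
- by move=> i; exact: ltW.
Qed.

(* The map phi is constant on the lifetimes of the scheduled packets, so an epoch
   either adds nothing to phi or serves no scheduled packet. *)
Lemma feasible_scheduled r tau s : feasible B ta td r tau -> inv ta td s ->
  \sum_(i in scheduled s) B i / r i <= T - phi s T.
Proof.
move=> [_ Br cap tau0 _] Is.
have BE i : B i / r i = \sum_j (if i \in packets_of ta td j then tau i j else 0).
  have [_ /eqP] := Br i; rewrite subr_eq0 => /eqP ->.
  by rewrite big_mkcond /=; apply: eq_bigr => j _; rewrite packets_epochs.
rewrite (eq_bigr _ (fun i _ => BE i)) exchange_big /=.
(* [u - phi s u] is the time removed before [u]; its increments over the epochs bound the time given
   to scheduled packets. *)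
have -> : T - phi s T = (T - phi s T) - (0 - phi s 0) by rewrite (phi_0 Is) subrr subr0.
rewrite -(telescope_epochs ta_0 ta_ge0 ta_lt_td (fun u => u - phi s u)).
apply: ler_sum => j _.
have [_ /ltW jj _] := epoch_bounds ta_ge0 ta_lt_td j.
have [i /andP[iK iF]|none] := pickP (fun i => (i \in scheduled s) && (i \in packets_of ta td j)).
  have -> : t_ j.+1 - phi s (t_ j.+1) - (t_ j - phi s (t_ j)) = epoch_length ta td j.
    have := iF; rewrite packets_epochs mem_epochs_of// => /andP[aj jd].
    have := scheduled_flat Is iK.
    have := phi_homo Is aj; have := phi_homo Is jd; have := phi_homo Is jj.
    by rewrite /epoch_length; lra.
  have := cap j; rewrite subr_le0; apply: le_trans.
  rewrite big_mkcond [leRHS]big_mkcond /=; apply: ler_sum => p _.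
  by case: ifP; case: ifP => // pF _; exact: tau0.
rewrite big1; first by have := phi_lip Is jj; lra.
by move=> p pK; have := none p; rewrite pK /= => ->.
Qed.

End Feasibility.

(** * Decreasing rates and the comparison of energies *)

Section Optimality.
Context {R : realType} {n : nat}.
Variables (B ta td : 'I_n.+1 -> R).
Hypothesis B_gt0 : forall i, 0 < B i.
Hypothesis ta_ge0 : forall i, 0 <= ta i.
Local Notation T := (horizon td).

(* Abel summation: the rates decrease along the run while the time T' gives to the
   scheduled packets never exceeds the time the run has used for them. *)
Lemma run_abel (h : R -> R) r x (T' : 'I_n.+1 -> R) s :
  (forall u, 0 < u -> 0 <= h u) -> (forall u v, 0 < u -> u <= v -> h u <= h v) ->
  (forall s', inv ta td s' -> \sum_(i in scheduled s') T' i <= T - phi s' T) ->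
  run B ta td r x s -> inv ta td s ->
  \sum_(i in scheduled s) B i / r i = T - phi s T ->
  forall b, 0 < b -> (forall a d, a <= d -> load B s a d <= b * (d - a)) ->
  \sum_(i | i \notin scheduled s) h (r i) * (T' i - B i / r i) <=
  - h b * \sum_(i in scheduled s) (T' i - B i / r i).
Proof.
move=> h0 hh T'le rs; pose D (s : @state R n) := \sum_(i in scheduled s) (T' i - B i / r i).
(* [b] bounds the intensities still to come and stands for the rate of the preceding round. *)
pose claim (s : @state R n) := inv ta td s -> \sum_(i in scheduled s) B i / r i = T - phi s T ->
  forall b, 0 < b -> (forall a d, a <= d -> load B s a d <= b * (d - a)) ->
  \sum_(i | i \notin scheduled s) h (r i) * (T' i - B i / r i) <= - h b * D s.
have D_le0 s' : inv ta td s' -> \sum_(i in scheduled s') B i / r i = T - phi s' T -> D s' <= 0.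
  by move=> Is' W; rewrite /D sumrB W subr_le0; exact: T'le.
suff step s' k l : round_spec B ta td r x s' k l -> claim (next_state td s' k l) -> claim s'.
  change (claim s); elim: rs => {}s k l sp K1 => [_|_ IH]; apply: step sp _ => // Is W b b0 _.
  rewrite big_pred0; last by move=> i; rewrite K1 inE.
  by rewrite mulNr oppr_ge0 mulr_ge0_le0 ?h0 ?D_le0.
move=> sp IH Is W b b0 loadb; have [crit rE _] := sp; have [ckl _] := crit.
have /and4P[_ _ kl _] := ckl.
have rho0 := intensity_gt0 B_gt0 ckl; set rho := intensity B s' k l in rho0 rE.
have I' := inv_next Is kl (abar_ge0 k ta_ge0 Is).
(* The load bound with [b], applied to the critical window itself, shows that rates do not
   increase. *)
have rhob : rho <= b.
  have := loadb _ _ (ltW kl); rewrite (load_critical B Is ckl) ler_pM2r//.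
  by rewrite subr_gt0.
have inE' i : i \in inside s' k l -> i \notin scheduled s' by rewrite inE => /andP[].
have sumK (F : 'I_n.+1 -> R) : \sum_(i in scheduled (next_state td s' k l)) F i =
    \sum_(i in scheduled s') F i + \sum_(i in inside s' k l) F i.
  rewrite big_mkcond [X in _ = X + _]big_mkcond [X in _ = _ + X]big_mkcond -big_split /=.
  apply: eq_bigr => i _; rewrite finset.in_setU; case: (boolP (i \in inside s' k l)) => iH.
    by rewrite orbT (negbTE (inE' i iH)) add0r.
  by rewrite orbF addr0.
have sumN (F : 'I_n.+1 -> R) : \sum_(i | i \notin scheduled s') F i =
    \sum_(i in inside s' k l) F i +
    \sum_(i | i \notin scheduled (next_state td s' k l)) F i.
  rewrite big_mkcond [X in _ = X + _]big_mkcond [X in _ = _ + X]big_mkcond -big_split /=.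
  apply: eq_bigr => i _; rewrite finset.in_setU; case: (boolP (i \in inside s' k l)) => iH.
    by rewrite (inE' i iH) orbT addr0.
  by rewrite orbF add0r.
(* Serving the critical packets at rate [rho] takes exactly the length of the window, which is what
   contraction removes from [phi s' T]. *)
have W' : \sum_(i in scheduled (next_state td s' k l)) B i / r i =
    T - phi (next_state td s' k l) T.
  rewrite sumK W (eq_bigr (fun i => B i / rho)); last by move=> i /rE ->.
  rewrite -mulr_suml (sum_inside _ _ _ Is) (load_critical B Is ckl) -/rho.
  rewrite mulrAC divff ?mul1r ?gt_eqF// /=.
  have : dbar s' l <= phi s' T by rewrite (dbarE Is) (phi_homo Is)// le_horizon.
  by move=> lT; rewrite contractE ?(ltW kl)// clamp_hi ?(ltW kl)//; ring.
have loadr a d : a <= d -> load B (next_state td s' k l) a d <= rho * (d - a).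
  by move=> ad; exact: (load_next_le B_gt0 Is crit ad).
have := IH I' W' rho rho0 loadr.
have D0 := D_le0 _ Is W; have hrho := hh _ _ rho0 rhob.
rewrite sumN.
have -> : \sum_(i in inside s' k l) h (r i) * (T' i - B i / r i) =
    h rho * \sum_(i in inside s' k l) (T' i - B i / r i).
  by rewrite mulr_sumr; apply: eq_bigr => i /rE ->.
have -> : D (next_state td s' k l) = D s' + \sum_(i in inside s' k l) (T' i - B i / r i).
  exact: sumK.
(* [D s'] is nonpositive, so [h rho <= h b] is reversed. *)
have : h b * D s' <= h rho * D s' by apply: ler_wnM2r.
by rewrite mulrDr; lra.
Qed.

End Optimality.

(* For a subgradient c of f at v, [c * v - f v] is the rate at which the energy of
   a packet sent at rate v decreases with its transmission time. *)
Lemma subgradient_gain (R : realType) (f : R -> R) :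
  convex_function (`[0, +oo[%classic : set R) f -> f 0 = 0 ->
  exists h : R -> R,
    [/\ forall u, 0 < u -> 0 <= h u,
        forall u v, 0 < u -> u <= v -> h u <= h v
      & forall b u v, 0 < b -> 0 < u -> 0 < v ->
          b / u * f u <= b / v * f v + h u * (b / v - b / u)].
Proof.
move=> fconv f0.
have /choice[c cP] : forall u, exists c, 0 < u ->
    forall y, 0 <= y -> f u + c * (y - u) <= f y.
  move=> u; have [u0|u0] := ltP 0 u; last by exists 0.
  by have [c cP] := convex_subgradient fconv u0; exists c.
exists (fun u => c u * u - f u); split.
- by move=> u u0; have := cP u u0 0 (lexx _); rewrite f0; lra.
- move=> u v u0; rewrite le_eqVlt => /orP[/eqP->//|uv].
  have v0 := lt_trans u0 uv.
  have h1 := cP u u0 v (ltW v0); have h2 := cP v v0 u (ltW u0).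
  have cuv : c u <= c v.
    have : 0 <= (c v - c u) * (v - u) by lra.
    by rewrite pmulr_lge0 ?subr_gt0// subr_ge0.
  have : 0 <= (c v - c u) * u by rewrite mulr_ge0 ?subr_ge0// ltW.
  by lra.
(* The supporting line at [u], evaluated at [v] and scaled by the transmission time [b / v]. *)
- move=> b u v b0 u0 v0; have h := cP u u0 v (ltW v0).
  have -> : b / v * f v = b / v * (f v - (f u + c u * (v - u))) +
      (b / v * (f u - c u * u) + c u * b) by field; rewrite gt_eqF.
  have : 0 <= b / v * (f v - (f u + c u * (v - u))).
    by rewrite mulr_ge0 ?subr_ge0// divr_ge0// ltW.
  have -> : b / u * f u = b / u * (f u - c u * u) + c u * b by field; rewrite gt_eqF.
  by lra.
Qed.

Theorem theorem2 (R : realType) (n : nat) (B ta td : 'I_n.+1 -> R) (f : R -> R)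
  (B_gt0 : forall i, 0 < B i)
  (ta0 : ta ord0 = 0)
  (ta_incr : forall i j : 'I_n.+1, (i < j)%N -> ta i < ta j)
  (ta_lt_td : forall i, ta i < td i)
  (f_ge0 : forall x, 0 <= x -> 0 <= f x)
  (f_convex : convex_function (`[0, +oo[%classic : set R) f)
  (f_incr : forall x y, 0 <= x -> x <= y -> f x <= f y)
  (f0 : f 0 = 0) :
  (exists r tau, algorithm1 B ta td r tau) /\
  forall r tau, algorithm1 B ta td r tau -> optimal B ta td f r tau.
Proof.
have ta_ge0 i : 0 <= ta i.
  have [->|i0] := eqVneq i ord0; first by rewrite ta0.
  by rewrite -ta0 ltW// ta_incr// lt0n.
have I0 := inv_init ta_lt_td.
have K0 : scheduled (init ta td) <> [set: 'I_n.+1]%SET.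
  by move=> /setP /(_ ord0); rewrite !inE.
split.
  have [r [x [mx rx]]] := exists_run B_gt0 ta_ge0 I0 K0.
  by exists r, (fun i j => fine (lebesgue_measure
    (epoch ta td j `&` [set t | x t = Some i])%classic)), x.
move=> r tau alg.
have [feas r_gt0] := algorithm1_feasible B_gt0 ta0 ta_ge0 ta_lt_td alg.
split=> // r' tau' feas'.
have r'_gt0 i : 0 < r' i.
  by have [_ /(_ i)[r'0 _] _ _ /(_ i)] := feas'; rewrite le_eqVlt eq_sym (negbTE r'0).
have [h [h0 hh hP]] := subgradient_gain f_convex f0.
have [k [l crit]] := exists_critical B I0 K0; have [ckl _] := crit.
have [x [_ rx _]] := alg.
(* Initially no packet is scheduled, so the right-hand side of [run_abel] vanishes; [b] is the first
   critical intensity. *)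
have := run_abel B_gt0 ta_ge0 h0 hh
  (fun s' => feasible_scheduled ta0 ta_ge0 ta_lt_td feas' (s := s')) rx I0 _
  (intensity_gt0 B_gt0 ckl) (fun a d => @load_le _ _ _ _ _ B_gt0 _ _ _ a d I0 crit).
rewrite !big_set0 mulr0 /= subrr => /(_ erefl) gain.
apply: (@le_trans _ _ (energy B f r' + \sum_i h (r i) * (B i / r' i - B i / r i))).
  by rewrite /energy -big_split /=; apply: ler_sum => i _; exact: hP.
suff : \sum_i h (r i) * (B i / r' i - B i / r i) <= 0 by lra.
by rewrite (eq_bigl (fun i => i \notin scheduled (init ta td)))// => i; rewrite inE.
Qed.
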